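(* If $A_1$ and $A_2$ are holomorphically finitely generated algebras, then so is their analytic free product $A_1\mathbin{\widehat *}A_2$.
   Context: All algebras are associative unital $\mathbb C$-algebras and all homomorphisms are unital. A locally $m$-convex algebra is a topological algebra whose topology is defined by a family of submultiplicative seminorms; an Arens-Michael algebra is a complete (Hausdorff) locally $m$-convex algebra; a Fréchet-Arens-Michael algebra is one whose underlying space is Fréchet. The analytic free product $A_1\mathbin{\widehat *}A_2$ of Arens-Michael algebras $A_1,A_2$ is their coproduct in the category of Arens-Michael algebras and continuous homomorphisms: an Arens-Michael algebra with continuous homomorphisms $j_k:A_k\to A_1\mathbin{\widehat *}A_2$ ($k=1,2$) such that for each Arens-Michael algebra $B$ and all continuous homomorphisms $\varphi_k:A_k\to B$ there is a unique continuous homomorphism $\varphi:A_1\mathbin{\widehat *}A_2\to B$ with $\varphi\circ j_k=\varphi_k$. It always exists and is unique up to a unique topological isomorphism compatible with the $j_k$. Let $W_n=\bigsqcup_{k\ge 0}\{1,\dots,n\}^k$, and for $\alpha=(\alpha_1,\dots,\alpha_k)\in W_n$ put $|\alpha|=k$ and $\zeta_\alpha=\zeta_{\alpha_1}\cdots\zeta_{\alpha_k}$ ($\zeta_\emptyset=1$). The algebra of free entire functions is $$\mathcal F_n=\Bigl\{a=\sum_{\alpha\in W_n}c_\alpha\zeta_\alpha:\ \|a\|_\rho=\sum_{\alpha\in W_n}|c_\alpha|\rho^{|\alpha|}<\infty\ \ \forall\rho>0\Bigr\}$$ (formal series in the free noncommuting variables $\zeta_1,\dots,\zeta_n$), with the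 topology given by the seminorms $\|\cdot\|_\rho$ and concatenation product. For an Arens-Michael algebra $A$, $a\in A^n$ and $f=\sum_\alpha c_\alpha\zeta_\alpha\in\mathcal F_n$ put $f(a)=\sum_\alpha c_\alpha a_\alpha\in A$, where $a_\alpha=a_{\alpha_1}\cdots a_{\alpha_k}$ and $a_\emptyset=1$. A subalgebra $B$ of a Fréchet-Arens-Michael algebra $A$ is holomorphically closed if $f(b)\in B$ for all $n\in\mathbb N$, $b\in B^n$, $f\in\mathcal F_n$. $\mathrm{Hol}(S)$, for $S\subseteq A$, is the intersection of all holomorphically closed subalgebras of $A$ containing $S$. A Fréchet-Arens-Michael algebra $A$ is holomorphically finitely generated (HFG) if $\mathrm{Hol}(S)=A$ for some finite subset $S\subseteq A$; in particular an HFG algebra is by definition a Fréchet-Arens-Michael algebra. *)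

(* Defs.v *)
From HB Require Import structures.
From mathcomp Require Import all_boot all_order all_algebra finmap.
From mathcomp Require Import all_classical all_reals topology normedtype esum.
From mathcomp Require Import complex.

Set Implicit Arguments.
Unset Strict Implicit.
Unset Printing Implicit Defensive.

Import Order.TTheory GRing.Theory Num.Theory.
Import numFieldNormedType.Exports.

Local Open Scope classical_set_scope.
Local Open Scope ring_scope.

(* The library's [algType] is built on nontrivial rings, whereas the zero      *)
(* algebra is a legitimate unital algebra, and no structure combining          *)
(* [PzRing] and [Lmodule] can be declared above [algType]. The ring operations *)
(* are therefore added to a topological vector space by a mixin, and the       *)
(* resulting [PzRing] instance is declared on the carrier of [topAlgType].     *)
(* A [Tvs] comes with a uniform structure inducing its topology, but unrelated *)
(* to its addition; [topalg_add_unif_continuous] forces it to be the           *)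
(* translation invariant one, so that completeness has its usual meaning.      *)
HB.mixin Record isTopologicalAlgebra (K : numDomainType) A
    & Tvs K A := {
  topalg_one : A ;
  topalg_mul : A -> A -> A ;
  topalg_mulA : associative topalg_mul ;
  topalg_mul1r : left_id topalg_one topalg_mul ;
  topalg_mulr1 : right_id topalg_one topalg_mul ;
  topalg_mulDl : left_distributive topalg_mul +%R ;
  topalg_mulDr : right_distributive topalg_mul +%R ;
  topalg_scaleAl : forall (k : K) x y,
    k *: topalg_mul x y = topalg_mul (k *: x) y ;
  topalg_scaleAr : forall (k : K) x y,
    k *: topalg_mul x y = topalg_mul x (k *: y) ;
  topalg_mul_continuous : continuous (fun z : A * A => topalg_mul z.1 z.2) ;
  topalg_add_unif_continuous : unif_continuous (fun z : A * A => z.1 + z.2)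
}.

#[short(type="topAlgType")]
HB.structure Definition TopologicalAlgebra (K : numDomainType) :=
  {A of Tvs K A & isTopologicalAlgebra K A}.

HB.instance Definition _ (K : numDomainType) (A : topAlgType K) :=
  GRing.Zmodule_isPzRing.Build A (@topalg_mulA K A) (@topalg_mul1r K A)
    (@topalg_mulr1 K A) (@topalg_mulDl K A) (@topalg_mulDr K A).

Definition complete_space (T : uniformType) : Prop :=
  forall F : set_system T, ProperFilter F -> cauchy F -> exists x : T, F --> x.

Section ArensMichael.
Variables (R : realType) (A : topAlgType R[i]).

Definition seminorm (p : A -> R) : Prop :=
  [/\ forall x, 0 <= p x,
      forall x y, p (x + y) <= p x + p y
    & forall (k : R[i]) x, p (k *: x) = Normc.normc k * p x].

Definition submultiplicative (p : A -> R) : Prop :=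
  forall x y, p (x * y) <= p x * p y.

Definition topology_defined_by (Q : set (A -> R)) : Prop :=
  forall (x : A) (U : set A), nbhs x U <->
    exists (J : set (A -> R)) (e : R),
      [/\ finite_set J, J `<=` Q, 0 < e
        & forall y, (forall p, J p -> p (y - x) < e) -> U y].

Definition locally_m_convex : Prop :=
  exists2 Q : set (A -> R),
    (forall p, Q p -> seminorm p /\ submultiplicative p)
    & topology_defined_by Q.

Definition arens_michael : Prop :=
  [/\ locally_m_convex, hausdorff_space A & complete_space A].

Definition frechet_space : Prop :=
  [/\ exists Q : set (A -> R),
        [/\ countable Q, Q `<=` seminorm & topology_defined_by Q],
      hausdorff_space A & complete_space A].

Definition frechet_arens_michael : Prop := arens_michael /\ frechet_space.

End ArensMichael.
Arguments arens_michael {R} A.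
Arguments frechet_arens_michael {R} A.

Definition continuous_hom (R : realType) (A B : topAlgType R[i])
    (phi : A -> B) : Prop :=
  [/\ linear phi, GRing.monoid_morphism phi & continuous phi].

Definition analytic_free_product (R : realType) (A1 A2 P : topAlgType R[i])
    (j1 : A1 -> P) (j2 : A2 -> P) : Prop :=
  [/\ arens_michael P, continuous_hom j1, continuous_hom j2
    & forall B : topAlgType R[i], arens_michael B ->
      forall (phi1 : A1 -> B) (phi2 : A2 -> B),
        continuous_hom phi1 -> continuous_hom phi2 ->
        exists! phi : P -> B,
          [/\ continuous_hom phi, phi \o j1 = phi1 & phi \o j2 = phi2]].

(* A formal series in n free variables is the family of its coefficients,      *)
(* indexed by the words on 'I_n.                                               *)
Definition free_norm (R : realType) n (rho : R) (c : seq 'I_n -> R[i])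
    : \bar R :=
  \esum_(w in [set: seq 'I_n]) (Normc.normc (c w) * rho ^+ size w)%:E.

Definition free_entire (R : realType) n : set (seq 'I_n -> R[i]) :=
  [set c | forall rho : R, 0 < rho -> (free_norm rho c < +oo)%E].

(* Unordered summation: the net of partial sums over finite sets of indices.   *)
Definition finite_subsets_filter (I : choiceType) : set_system {fset I} :=
  filter_from [set: {fset I}] (fun J => [set J' | (J `<=` J')%fset]).
Arguments finite_subsets_filter I : clear implicits.

Section HolomorphicallyClosed.
Variables (R : realType) (A : topAlgType R[i]).

(* [xget] picks the sum; it exists and is unique when A is an Arens-Michael    *)
(* algebra and c is entire.                                                    *)
Definition free_eval n (c : seq 'I_n -> R[i]) (a : 'I_n -> A) : A :=
  xget 0 [set s : A |
    (fun J : {fset seq 'I_n} => \sum_(w <- J) c w *: \prod_(i <- w) a i)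
      @ finite_subsets_filter (seq 'I_n) --> s].

Definition subalgebra (B : set A) : Prop :=
  [/\ B 1, forall (k : R[i]) x y, B x -> B y -> B (k *: x + y)
    & forall x y, B x -> B y -> B (x * y)].

Definition holomorphically_closed (B : set A) : Prop :=
  subalgebra B /\
  forall n (b : 'I_n -> A) (f : seq 'I_n -> R[i]),
    (forall i, B (b i)) -> free_entire f -> B (free_eval f b).

Definition Hol (S : set A) : set A := smallest holomorphically_closed S.

End HolomorphicallyClosed.

Definition HFG (R : realType) (A : topAlgType R[i]) : Prop :=
  frechet_arens_michael A /\
  exists2 S : set A, finite_set S & Hol S = [set: A].

(* Main.v *)
From HB Require Import structures.
Require Import Defs.
From mathcomp Require Import all_boot all_order all_algebra finmap.
From mathcomp Require Import all_classical all_reals topology ereal normedtype.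
From mathcomp Require Import sequences esum convex interval_inference complex.
From mathcomp Require Import lra ring.

(** Let P be the free product of A1 and A2, with canonical maps j1 and j2, and
let a list the images in P of finite sets of generators of A1 and A2. The
elements f(a), for f a free entire series, form a subalgebra X of P. It is the
quotient of the Fréchet algebra of free entire series by the kernel of
evaluation at a, and with the quotient seminorms it is itself a Fréchet
Arens-Michael algebra whose inclusion into P is a continuous homomorphism
([entire_algebra_am], [entire_val_hom]). The whole point is to show that X is
all of P, with the same topology, by means of the universal property alone.

The subalgebra X is holomorphically closed in P for a reason that avoids
substituting power series into power series: for b in X^n, the sum f(b) already
exists in X, because X is Arens-Michael, and the continuous inclusion carries it
to the sum in P ([entire_values_closed]). The preimage of X under j1 is then
holomorphically closed in A1 and contains the generators of A1, so j1 maps A1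
into X; likewise for j2.

These corestrictions A1 -> X and A2 -> X are continuous by the closed graph
theorem for Fréchet spaces ([entire_lift]): on A1, the seminorms of A1 and their
sums with the pulled back seminorms of X define two comparable complete
metrizable topologies, which coincide ([finer_seminorms_continuous]). The
universal property extends them to a continuous homomorphism phi : P -> X, and
composing with the inclusion X -> P gives the identity of P by uniqueness. Hence
X is P as a topological algebra: P is Fréchet, and each of its elements is f(a)
for some free entire f, so that it lies in the holomorphic closure of the
generators. *)

Set Implicit Arguments.
Unset Strict Implicit.
Unset Printing Implicit Defensive.

Import Order.TTheory GRing.Theory Num.Theory.
Import numFieldNormedType.Exports.

Local Open Scope classical_set_scope.
Local Open Scope ring_scope.

(** * Seminorms and the topologies they define *)

Lemma normc_ge0 (R : rcfType) (k : R[i]) : 0 <= Normc.normc k.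
Proof. by case: k => a b /=; apply: sqrtr_ge0. Qed.

Lemma normcN1 (R : rcfType) : Normc.normc (-1 : R[i]) = 1.
Proof. by rewrite /Normc.normc /= oppr0 expr0n addr0 sqrrN expr1n sqrtr1. Qed.

Section SeminormTheory.
Variables (R : realType) (A : topAlgType R[i]) (p : A -> R).
Hypothesis hp : seminorm p.

Lemma seminorm_ge0 x : 0 <= p x. Proof. by case: hp. Qed.

Lemma seminormD x y : p (x + y) <= p x + p y. Proof. by case: hp. Qed.

Lemma seminormZ k x : p (k *: x) = Normc.normc k * p x. Proof. by case: hp. Qed.

Lemma seminorm0 : p 0 = 0.
Proof. by rewrite -(scale0r 0) seminormZ Normc.normc0 mul0r. Qed.

Lemma seminormN x : p (- x) = p x.
Proof. by rewrite -scaleN1r seminormZ normcN1 mul1r. Qed.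

Lemma seminormB x y : p (x - y) = p (y - x).
Proof. by rewrite -opprB seminormN. Qed.

Lemma seminorm_dist y x z : p (x - z) <= p (x - y) + p (y - z).
Proof. by rewrite (_ : x - z = (x - y) + (y - z)) ?seminormD// subrKA. Qed.

Lemma seminorm_sum (I : Type) (s : seq I) (F : I -> A) :
  p (\sum_(i <- s) F i) <= \sum_(i <- s) p (F i).
Proof.
elim: s => [|i s IH]; first by rewrite !big_nil seminorm0.
by rewrite !big_cons (le_trans (seminormD _ _))// lerD2l.
Qed.

End SeminormTheory.

Lemma finite_gauge_ball (R : realType) (A : topAlgType R[i])
    (F : set_system A) (FF : Filter F) (J : set (A -> R)) x e :
  finite_set J -> (forall p, J p -> F [set y | p (y - x) < e]) ->
  F [set y | forall p, J p -> p (y - x) < e].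
Proof.
move=> /finite_seqP [S JS] h.
have hS : forall p, p \in S -> F [set y | p (y - x) < e].
  by move=> p pS; apply: h; rewrite JS.
suff : F [set y | forall p, p \in S -> p (y - x) < e].
  by apply: filterS => y hy p; rewrite JS; apply: hy.
elim: S hS {JS} => [|p S IH] hS; first by apply: filterS filterT => y _ p.
have px := hS p (mem_head _ _).
have Sx := IH (fun q qS => hS q (mem_behead (s := p :: S) qS)).
apply: (@filterS _ F FF _ _ _ (@filterI _ F FF _ _ px Sx)) => y [h1 h2] q.
by rewrite inE => /orP[/eqP ->//|/h2].
Qed.

Lemma topology_defined_byI (R : realType) (A : topAlgType R[i])
    (Q : set (A -> R)) :
  (forall p x e, Q p -> 0 < e -> nbhs x [set y | p (y - x) < e]) ->
  (forall x U, nbhs x U ->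
    exists p e, [/\ Q p, 0 < e & forall y, p (y - x) < e -> U y]) ->
  topology_defined_by Q.
Proof.
move=> Qball ballQ x U; split.
  move=> /ballQ [p [e [Qp e0 He]]]; exists [set p], e; split=> //.
    by move=> _ ->.
  by move=> y h; apply: He; exact: h.
move=> [J [e [Jfin JQ e0 He]]].
apply: (@filterS _ (nbhs x) _ _ _ He); apply: finite_gauge_ball => // p Jp.
by apply: Qball => //; exact: JQ.
Qed.

Section Gauges.
Variables (R : realType) (A : topAlgType R[i]) (Q : set (A -> R)).
Hypotheses (semQ : Q `<=` @seminorm R A) (topQ : topology_defined_by Q).

Lemma gauge_nbhs p x e : Q p -> 0 < e -> nbhs x [set y | p (y - x) < e].
Proof.
move=> Qp e0; apply/topQ; exists [set p], e; split=> //; first by move=> _ ->.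
by move=> y; apply.
Qed.

Lemma gauge_cvg (F : set_system A) (FF : Filter F) x :
  (forall p e, Q p -> 0 < e -> F [set y | p (y - x) < e]) -> F --> x.
Proof.
move=> h U /topQ [J [e [Jfin JQ e0 He]]].
apply: filterS He _; apply: finite_gauge_ball => // p Jp.
by apply: h => //; exact: JQ.
Qed.

(** The filter is Cauchy for the uniform structure as well, since uniform
continuity of the addition makes that structure the translation invariant one. *)
Lemma gauge_cauchy (F : set_system A) (FF : ProperFilter F) :
  complete_space A ->
  (forall p e, Q p -> 0 < e ->
     exists2 B, F B & forall y z, B y -> B z -> p (z - y) < e) ->
  exists x : A, F --> x.
Proof.
move=> cA h; apply: cA => E entE.
(* [topalg_add_unif_continuous] applied to the sum of the pairs (x, x), which *)
(* lies in every entourage, and (0, y - x) gives (x, y) *)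
have [U U0 UE] : exists2 U, nbhs (0 : A) U & forall x y, U (y - x) -> E (x, y).
  have [[E1 E2] /= [e1 e2] E12] := @topalg_add_unif_continuous R[i] A E entE.
  exists (xsection E2 0); first exact: nbhs_entourage.
  move=> x y /xsectionP xy.
  have /= := E12 ((x, x), (0, y - x)).
  move=> []; first by split=> //=; exact: entourage_refl.
  move=> [[a b] [c d]] /= + [? ? ? ?]; subst.
  by rewrite addr0 [x + _]addrC subrK.
have /topQ [J [e [Jfin JQ e0 He]]] := U0.
have [S JS] : exists S : seq (A -> R), J = [set` S].
  by have /finite_seqP := Jfin.
have hS : forall p, p \in S -> Q p by move=> p pS; apply: JQ; rewrite JS.
suff [B FB HB] : exists2 B, F B &
    forall y z, B y -> B z -> forall p, p \in S -> p (z - y) < e.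
  exists (B, B) => // -[y z] /= [By Bz]; apply/UE/He => p; rewrite JS subr0.
  exact: HB.
elim: S hS {JS} => [|p S IH] hS; first by exists setT; [exact: filterT|].
have Qp : Q p by apply: hS; rewrite mem_head.
have [B FB HB] := IH (fun q qS => hS q (mem_behead (s := p :: S) qS)).
have [C FC HC] := h p e Qp e0.
exists (B `&` C); first exact: filterI.
move=> y z [By Cy] [Bz Cz] q; rewrite inE => /orP[/eqP ->|]; first exact: HC.
exact: HB.
Qed.

Lemma gauge_separated x : hausdorff_space A -> (forall p, Q p -> p x = 0) -> x = 0.
Proof.
move=> hA px; apply: hA => U V Ux V0; exists 0; split; last exact: nbhs_singleton.
have /topQ [J [e [Jfin JQ e0 He]]] := Ux; apply: He => p Jp.
by rewrite sub0r seminormN ?px//; [exact: JQ|exact/semQ/JQ].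
Qed.

End Gauges.

Definition increasing_seminorms (R : realType) (A : topAlgType R[i])
    (p : nat -> A -> R) :=
  (forall k, seminorm (p k)) /\ forall k x, p k x <= p k.+1 x.

Definition tends_to (R : realType) (A : topAlgType R[i]) (p : nat -> A -> R)
    (x : nat -> A) (l : A) :=
  forall k e, 0 < e -> exists M, forall m, (M <= m)%N -> p k (x m - l) < e.

(** Sequential completeness, tested only on sequences whose increments decay
geometrically; for an increasing sequence of seminorms this is equivalent to
completeness. *)
Definition fast_complete (R : realType) (A : topAlgType R[i])
    (p : nat -> A -> R) :=
  forall x : nat -> A,
    (forall j, p j (x j.+1 - x j) <= 2^-1 ^+ j) -> exists l, tends_to p x l.

Section Sequences.
Variables (R : realType) (A : topAlgType R[i]) (p : nat -> A -> R).
Hypothesis hp : increasing_seminorms p.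

Lemma seminorms_le k m x : (k <= m)%N -> p k x <= p m x.
Proof.
move=> /subnK <-; elim: (m - k)%N => // i; rewrite addSn => /le_trans; apply.
by case: hp.
Qed.

Lemma fast_tail (x : nat -> A) :
  (forall j, p j (x j.+1 - x j) <= 2^-1 ^+ j) ->
  forall k m n, (k <= m)%N -> (m <= n)%N -> p k (x n - x m) <= 2 * 2^-1 ^+ m.
Proof.
move=> hx k m n km /subnK <-; have [semp _] := hp.
suff : forall i, p k (x (i + m)%N - x m) <= 2 * 2^-1 ^+ m - 2 * 2^-1 ^+ (i + m).
  by move=> /(_ (n - m)%N)/le_trans; apply; rewrite gerBl mulr_ge0.
elim=> [|i IH]; first by rewrite add0n !subrr seminorm0.
rewrite addSn (le_trans (seminorm_dist (semp k) (x (i + m)%N) _ _))//.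
have h1 : p k (x (i + m).+1 - x (i + m)%N) <= 2^-1 ^+ (i + m).
  apply: le_trans (hx _); apply: seminorms_le.
  exact/(leq_trans km)/leq_addl.
by rewrite exprS mulrA divff// mul1r; lra.
Qed.

Lemma pow2_small (e : R) : 0 < e -> exists M, forall m, (M <= m)%N -> 2 * 2^-1 ^+ m < e.
Proof.
move=> e0; have e20 : 0 < e / 2 by rewrite divr_gt0.
have : (fun m => 2^-1 ^+ m : R) @ \oo --> (0 : R).
  by apply: cvg_expr; rewrite ger0_norm// invf_lt1// ltr1n.
move=> /cvgrPdist_lt /(_ _ e20) [M _ HM]; exists M => m /HM /=.
by rewrite sub0r normrN ger0_norm ?exprn_ge0// ltr_pdivlMr// mulrC.
Qed.

Lemma complete_fast_complete :
  topology_defined_by (range p) -> complete_space A -> fast_complete p.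
Proof.
move=> topp cA x hx; have [semp _] := hp.
have semQ : range p `<=` @seminorm R A by move=> _ [k _ <-].
have [|l xl] := @gauge_cauchy R A (range p) topp (x @ \oo) _ cA.
  move=> _ e [k _ <-] e0; have e20 : 0 < e / 2 by rewrite divr_gt0.
  have [M HM] := pow2_small e20.
  exists [set x m | m in [set m | (maxn k M <= m)%N]].
    by exists (maxn k M) => // m /= hm; exists m.
  move=> _ _ [m /= + <-] [n /= + <-]; rewrite !geq_max => /andP[km Mm] /andP[kn Mn].
  rewrite (le_lt_trans (seminorm_dist (semp k) (x (maxn k M)) _ _))//.
  have hM := HM _ (leq_maxr k M).
  have h1 : p k (x n - x (maxn k M)) <= 2 * 2^-1 ^+ maxn k M.
    by apply: fast_tail => //; rewrite ?leq_maxl// geq_max kn.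
  have h2 : p k (x m - x (maxn k M)) <= 2 * 2^-1 ^+ maxn k M.
    by apply: fast_tail => //; rewrite ?leq_maxl// geq_max km.
  by rewrite [X in _ + X]seminormB; last exact: semp; lra.
exists l => k e e0.
have /xl [M _ HM] : nbhs l [set y | p k (y - l) < e].
  by apply: (gauge_nbhs topp) => //; exists k.
by exists M => m /HM.
Qed.

End Sequences.

Lemma tends_to_cvg (R : realType) (A : topAlgType R[i]) (p : nat -> A -> R) x l :
  topology_defined_by (range p) -> tends_to p x l -> x @ \oo --> l.
Proof.
move=> topp xl; apply: (gauge_cvg topp) => _ e [k _ <-] e0.
by have [M HM] := xl k e e0; exists M => // m; exact: HM.
Qed.

(** * Comparable Fréchet topologies coincide *)

Lemma normc_real (R : rcfType) (t : R) : 0 <= t -> Normc.normc (t%:C)%C = t.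
Proof. by move=> t0; rewrite /Normc.normc /= expr0n /= addr0 sqrtr_sqr ger0_norm. Qed.

Section ComparableFrechet.
Variables (R : realType) (A : topAlgType R[i]) (p q : nat -> A -> R).
Hypotheses (hp : increasing_seminorms p) (hq : increasing_seminorms q).
Hypothesis pq : forall k x, p k x <= q k x.
Hypothesis p_separated : forall x, (forall k, p k x = 0) -> x = 0.
Hypotheses (p_complete : fast_complete p) (q_complete : fast_complete q).

Let semp k : seminorm (p k). Proof. by case: hp. Qed.
Let semq k : seminorm (q k). Proof. by case: hq. Qed.

(** Inclusion of the open p_k-ball of radius d in the p-closure of the closed
unit q_N-ball. *)
Definition almost_covered N k (d : R) := forall x, p k x < d ->
  forall k' (e : R), 0 < e -> exists y, q N y <= 1 /\ p k' (x - y) < e.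

(** The closure of the unit q_N-ball is convex and symmetric. If its multiple by
m.+1 contained both reflected points x0 + zM and x0 - zM, it would contain half
their difference zM, whence z would lie in the closure of the unit ball. So as
soon as that closure contains no p-ball around 0, its multiples contain no p-ball
around any point. *)
Lemma not_covered_shift N :
  (forall k d, 0 < d -> ~ almost_covered N k d) ->
  forall x0 k (d : R) m, 0 < d -> exists x, p k (x - x0) < d /\
    exists k' (e : R), 0 < e /\ forall y, q N y <= m.+1%:R -> e <= p k' (x - y).
Proof.
move=> H x0 k d m d0; pose M : R := m.+1%:R.
have M0 : 0 < M by rewrite ltr0n.
have [z [zd [k' [e [e0 hz]]]]] : exists z, p k z < d / M /\
    exists k' (e : R), 0 < e /\ forall y, q N y <= 1 -> e <= p k' (z - y).
  apply: contrapT => nz; apply: (H k (d / M)); first by rewrite divr_gt0.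
  move=> z zd k' e e0; apply: contrapT => ny; apply: nz; exists z; split=> //.
  exists k', e; split=> // y qy; rewrite leNgt; apply/negP => zy.
  by apply: ny; exists y.
pose zM := (M%:C)%C *: z.
have zMd : p k zM < d.
  by rewrite seminormZ// normc_real ?(ltW M0)// mulrC -ltr_pdivlMr.
apply: contrapT => nx.
have near x : p k (x - x0) < d -> exists y, q N y <= M /\ p k' (x - y) < e.
  move=> xd; apply: contrapT => ny; apply: nx; exists x; split=> //.
  exists k', e; split=> // y qy; rewrite leNgt; apply/negP => xy.
  by apply: ny; exists y.
have [|y1 [q1 p1]] := near (x0 + zM); first by rewrite [x0 + _]addrC addrK.
have [|y2 [q2 p2]] := near (x0 - zM).
  by rewrite [x0 - _]addrC addrK seminormN.
(* y1 and y2 approximate the two reflected points, so t (y1 - y2) approximates z *)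
pose t : R := (M + M)^-1.
have t0 : 0 < t by rewrite invr_gt0 addr_gt0.
have tM : t * (M + M) = 1 by rewrite mulVf// gt_eqF// addr_gt0.
have := hz ((t%:C)%C *: (y1 - y2)).
rewrite seminormZ// normc_real ?(ltW t0)//.
have -> : z - (t%:C)%C *: (y1 - y2) =
    (t%:C)%C *: ((x0 + zM - y1) - (x0 - zM - y2)).
  have -> : (x0 + zM - y1) - (x0 - zM - y2) = (zM + zM) - (y1 - y2).
    have -> : x0 + zM - y1 = (zM - y1) + x0 by rewrite -addrA addrC.
    have -> : x0 - zM - y2 = (- zM - y2) + x0 by rewrite -addrA addrC.
    rewrite opprD addrACA subrr addr0 opprD !opprK addrACA; congr (_ + _).
    by rewrite opprB addrC.
  rewrite [RHS]scalerBr; congr (_ - _).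
  rewrite /zM -scalerDl scalerA -rmorphD -rmorphM.
  by rewrite tM scale1r.
rewrite seminormZ// normc_real ?(ltW t0)//.
have h1 : q N (y1 - y2) <= M + M.
  by apply: le_trans (seminormD (semq N) _ _) _; rewrite seminormN// lerD.
have h2 : p k' ((x0 + zM - y1) - (x0 - zM - y2)) < e + e.
  by apply: le_lt_trans (seminormD (semp k') _ _) _; rewrite seminormN// ltrD.
have h3 : t * q N (y1 - y2) <= 1 by rewrite -tM ler_pM2l.
move=> /(_ h3); rewrite leNgt => /negP; apply.
have h4 : t * p k' ((x0 + zM - y1) - (x0 - zM - y2)) < t * (e + e) by rewrite ltr_pM2l.
apply: lt_le_trans h4 _; rewrite -[leRHS]mul1r -tM -mulrA ler_pM2l//.
have : 1 <= M by rewrite /M ler1n.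
by move=> M1; rewrite mulrDl lerD// ler_peMl// ltW.
Qed.

(** Baire category argument: otherwise one builds shrinking nested p-balls such
that q_N exceeds m on the ball of index m.+1, and q_N would exceed every integer
at their common point. *)
Lemma almost_coveredP N : exists k (d : R), 0 < d /\ almost_covered N k d.
Proof.
apply: contrapT => H0.
have H k d : 0 < d -> ~ almost_covered N k d.
  by move=> d0 hc; apply: H0; exists k, d.
(* a state is the centre, the index of the seminorm and the radius of a ball *)
pose ball (s : A * nat * R) y := p s.1.2 (y - s.1.1) <= s.2.
have /choice [next hnext] : forall sm : (A * nat * R) * nat,
    exists s' : A * nat * R, 0 < sm.1.2 ->
    [/\ 0 < s'.2, s'.2 <= 2^-1 ^+ sm.2.+1, (sm.2 < s'.1.2)%N,
       forall y, ball s' y -> ball sm.1 y &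
       forall y, ball s' y -> sm.2%:R < q N y].
  move=> [[[x k] d] m] /=.
  have [d0|d0] := ltP 0 d; last by exists (x, k, d).
  have d20 : 0 < d / 2 by rewrite divr_gt0.
  have [x' [xx' [k' [e [e0 he]]]]] := not_covered_shift H x k m d20.
  pose d' := Num.min (d / 2) (Num.min (e / 2) (2^-1 ^+ m.+1)).
  exists (x', maxn k (maxn k' m.+1), d') => _ /=; split.
  - by rewrite !lt_min d20 divr_gt0//= exprn_gt0.
  - by rewrite !ge_min lexx !orbT.
  - by rewrite !leq_max leqnn !orbT.
  - move=> y; rewrite /ball /= => hy; rewrite (splitr d).
    apply: le_trans (seminorm_dist (semp k) x' _ _) _.
    apply: lerD; last exact: ltW.
    apply: (@le_trans _ _ d').
      by apply: (le_trans _ hy); exact/(seminorms_le hp)/leq_maxl.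
    by rewrite ge_min lexx.
  - move=> y; rewrite /ball /= => hy; rewrite ltNge; apply/negP => qy.
    have /he : q N y <= m.+1%:R by apply: (le_trans qy); rewrite ler_nat.
    rewrite leNgt => /negP; apply.
    rewrite seminormB//; apply: (@le_lt_trans _ _ (e / 2)).
      apply: (@le_trans _ _ d'); last by rewrite !ge_min lexx orbT.
      apply: (le_trans _ hy); apply: (seminorms_le hp).
      by rewrite !leq_max leqnn orbT.
    by rewrite ltr_pdivrMr// ltr_pMr// ltr1n.
pose S := nat_rect (fun=> (A * nat * R)%type) (0, 0%N, 1) (fun m s => next (s, m)).
have SS m : S m.+1 = next (S m, m) by [].
have S0 m : 0 < (S m).2.
  by elim: m => [|m IH] //=; have [] := hnext (S m, m) IH.
have Sd m : (S m).2 <= 2^-1 ^+ m.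
  by case: m => [|m]; rewrite ?expr0// SS; have [] := hnext (S m, m) (S0 m).
have Sk m : (m <= (S m).1.2)%N.
  by case: m => [|m] //; rewrite SS; have [] := hnext (S m, m) (S0 m).
have Snest m y : ball (S m.+1) y -> ball (S m) y.
  by rewrite SS; have [_ _ _ h _] := hnext (S m, m) (S0 m); exact: h.
have Scentre m : ball (S m) (S m).1.1.
  by rewrite /ball subrr seminorm0// ltW.
have Sin m i : ball (S m) (S (i + m)%N).1.1.
  elim: i m => [|i IH] m //.
  by apply: Snest; rewrite addSnnS.
have [l hl] : exists l, tends_to p (fun m => (S m).1.1) l.
  apply: p_complete => j; apply: (le_trans _ (Sd j)).
  by apply: (le_trans _ (Sin j 1%N)); exact: (seminorms_le hp).
have lin m : ball (S m) l.
  rewrite /ball; apply/ler_addgt0Pr => e e0.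
  have [M HM] := hl (S m).1.2 _ e0.
  apply: le_trans (seminorm_dist (semp _) (S (M + m)%N).1.1 _ _) _.
  rewrite addrC lerD//; first exact: Sin.
  by rewrite seminormB// ltW// HM// leq_addr.
have ql m : m%:R < q N l.
  by have [_ _ _ _] := hnext (S m, m) (S0 m); apply; rewrite -SS; exact: lin.
have := ql (Num.truncn (q N l)).+1.
by rewrite ltNge ltW// truncnS_gt.
Qed.

(** The open mapping theorem for the identity. A point x of a small p-ball is
approximated by a point of a q-ball with an error in a smaller p-ball, which is
approximated in turn; the corrections decay geometrically for q, so they sum to
some l in the finer topology, and l = x since their sum also converges to x in
the coarser one. *)
Lemma finer_seminorms_continuous N (e : R) : 0 < e ->
  exists k (d : R), 0 < d /\ forall x, p k x < d -> q N x < e.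
Proof.
suff [k [d [d0 hd]]] : exists k (d : R), 0 < d /\ forall x, p k x < d -> q N x <= 2.
  move=> e0; exists k, (d * (e / 3)); split; first by rewrite mulr_gt0// divr_gt0.
  move=> x xd; pose t : R := 3 / e.
  have t0 : 0 < t by rewrite divr_gt0.
  have := hd ((t%:C)%C *: x); rewrite !seminormZ// normc_real ?(ltW t0)//.
  rewrite mulrC -ltr_pdivlMr// /t invf_div => /(_ xd).
  rewrite mulrC -ler_pdivlMr// invf_div => /le_lt_trans; apply.
  by rewrite mulrA ltr_pdivrMr// [ltRHS]mulrC ltr_pM2r// ltr_nat.
clear e.
have /choice [kf /choice [df hdf]] := almost_coveredP.
have df0 M : 0 < df M by have [] := hdf M.
have cover M r (t : R) : 0 < t -> p (kf M) r < df M * t ->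
    forall k' (e' : R), 0 < e' -> exists y, q M y <= t /\ p k' (r - y) < e'.
  move=> t0 hr k' e' e'0; have [_ hc] := hdf M.
  have ti0 : 0 < t^-1 by rewrite invr_gt0.
  have [||y [qy py]] := hc ((t^-1%:C)%C *: r) _ k' (e' / t).
    by rewrite seminormZ// normc_real ?(ltW ti0)// mulrC ltr_pdivrMr.
    by rewrite divr_gt0.
  exists ((t%:C)%C *: y); rewrite seminormZ// normc_real ?(ltW t0)//; split.
    by rewrite ler_piMr// ltW.
  have -> : r - (t%:C)%C *: y = (t%:C)%C *: ((t^-1%:C)%C *: r - y).
    by rewrite scalerBr scalerA -rmorphM /= mulfV ?gt_eqF// scale1r.
  by rewrite seminormZ// normc_real ?(ltW t0)// mulrC -ltr_pdivlMr.
pose h j : R := 2^-1 ^+ j.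
have h0 j : 0 < h j by rewrite exprn_gt0.
exists (kf N), (df N * h N); split; first by rewrite mulr_gt0.
move=> x hx.
have /choice [next hnext] : forall rj : A * nat, exists y,
    p (kf (rj.2 + N)%N) rj.1 < df (rj.2 + N)%N * h (rj.2 + N)%N ->
    [/\ q (rj.2 + N)%N y <= h (rj.2 + N)%N,
        p (kf (rj.2.+1 + N)%N) (rj.1 - y) < df (rj.2.+1 + N)%N * h (rj.2.+1 + N)%N &
        p rj.2 (rj.1 - y) < h rj.2].
  move=> [r j] /=; apply: contrapT => ny; apply: (ny); exists 0 => hr; exfalso.
  pose k' := maxn (kf (j.+1 + N)%N) j.
  pose e' := Num.min (df (j.+1 + N)%N * h (j.+1 + N)%N) (h j).
  have [|y [qy py]] := cover (j + N)%N r (h (j + N)%N) (h0 _) hr k' e'.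
    by rewrite lt_min h0 mulr_gt0.
  apply: ny; exists y => _; split=> //.
    apply: le_lt_trans (seminorms_le hp _ (leq_maxl _ _)) (lt_le_trans py _).
    by rewrite ge_min lexx.
  apply: le_lt_trans (seminorms_le hp _ (leq_maxr _ _)) (lt_le_trans py _).
  by rewrite ge_min lexx orbT.
pose r := nat_rect (fun=> A) x (fun j r => r - next (r, j)).
have rS j : r j.+1 = r j - next (r j, j) by [].
have rsmall j : p (kf (j + N)%N) (r j) < df (j + N)%N * h (j + N)%N.
  by elim: j => [|j IH] //=; have [_ h1 _] := hnext (r j, j) IH; exact: h1.
have ysmall j : q (j + N)%N (next (r j, j)) <= h (j + N)%N.
  by have [] := hnext (r j, j) (rsmall j).
have rto0 j : p j (r j.+1) < h j.
  by have [] := hnext (r j, j) (rsmall j).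
(* r j is the error left after j corrections, u j the sum of these corrections *)
pose u j := x - r j.
have uS j : u j.+1 - u j = next (r j, j).
  by rewrite /u rS !opprB [x + _]addrC -addrA (addrC x) !subrK.
have [l hl] : exists l, tends_to q u l.
  apply: q_complete => j; rewrite uS.
  apply: le_trans (seminorms_le hq _ (leq_addr N j)) _.
  apply: le_trans (ysmall j) _; rewrite /h exprD ler_piMr ?exprn_ge0//.
  by rewrite exprn_ile1// invf_le1// ler1n.
have xl : x = l.
  apply/eqP; rewrite -subr_eq0; apply/eqP/p_separated => k.
  apply/eqP; rewrite eq_le seminorm_ge0// andbT; apply/ler_addgt0Pr => e e0.
  have e20 : 0 < e / 2 by rewrite divr_gt0.
  have [M1 H1] := hl k _ e20; have [M2 H2] := pow2_small e20.
  pose m := maxn k (maxn M1 M2).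
  apply: le_trans (seminorm_dist (semp k) (u m.+1) _ _) _.
  rewrite add0r (splitr e) lerD//; last first.
    apply/ltW/(le_lt_trans (pq _ _))/H1; apply: leqW.
    by rewrite /m !leq_max leqnn !orbT.
  rewrite /u opprB addrC subrK.
  apply: le_trans (seminorms_le hp _ (leq_maxl k (maxn M1 M2))) _.
  apply: le_trans (ltW (rto0 m)) _.
  have := H2 m; rewrite /m !leq_max leqnn !orbT => /(_ isT) /ltW; apply: le_trans.
  by rewrite /h ler_peMl ?exprn_ge0// ler1n.
have ub m : q N (u m) <= 2 - 2 * h m.
  elim: m => [|m IH]; first by rewrite /u /h subrr seminorm0// expr0 mulr1 subrr.
  have -> : u m.+1 = u m + next (r m, m) by rewrite -uS addrC subrK.
  apply: le_trans (seminormD (semq N) _ _) _.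
  have h1 : q N (next (r m, m)) <= h m.
    apply: le_trans (seminorms_le hq _ (leq_addl m N)) (le_trans (ysmall m) _).
    by rewrite /h exprD ler_piMr ?exprn_ge0// exprn_ile1// invf_le1// ler1n.
  have : h m = 2 * h m.+1 by rewrite /h exprS mulrA divff// mul1r.
  by lra.
apply/ler_addgt0Pr => e e0; have [M HM] := hl N _ e0.
have -> : q N x = q N ((l - u M) + u M) by rewrite subrK xl.
apply: le_trans (seminormD (semq N) _ _) _.
rewrite seminormB// addrC lerD//; last by rewrite ltW// HM.
by apply: le_trans (ub M) _; rewrite gerBl mulr_ge0// ltW.
Qed.

End ComparableFrechet.

(** * Free entire series *)

Section FreeSeries.
Variables (R : realType) (n : nat).
Local Notation word := (seq 'I_n).
Implicit Types (c d : word -> R[i]) (J K : seq word).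

(** The bound M on the norm of radius rho, read off the finite partial sums: it
keeps all estimates in R rather than in the extended reals. *)
Definition norm_le (rho : R) c (M : R) :=
  forall J, uniq J -> \sum_(w <- J) Normc.normc (c w) * rho ^+ size w <= M.

Lemma norm_le_ge0 rho c M : norm_le rho c M -> 0 <= M.
Proof. by move=> /(_ [::] isT); rewrite big_nil. Qed.

Lemma norm_le_trans rho c M N : norm_le rho c M -> M <= N -> norm_le rho c N.
Proof. by move=> h MN J uJ; apply: le_trans (h J uJ) MN. Qed.

Lemma norm_le_radius rho sigma c M :
  0 <= rho -> rho <= sigma -> norm_le sigma c M -> norm_le rho c M.
Proof.
move=> r0 rs h J uJ; apply: le_trans (h J uJ).
by apply: ler_sum => w _; rewrite ler_wpM2l ?normc_ge0// lerXn2r// nnegrE (le_trans r0).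
Qed.

Lemma norm_leD rho c d M N : 0 <= rho -> norm_le rho c M -> norm_le rho d N ->
  norm_le rho (fun w => c w + d w) (M + N).
Proof.
move=> r0 hc hd J uJ; apply: le_trans (lerD (hc J uJ) (hd J uJ)).
rewrite -big_split /=; apply: ler_sum => w _.
by rewrite -mulrDl ler_wpM2r ?exprn_ge0// le_normcD.
Qed.

Lemma norm_leZ rho (k : R[i]) c M : norm_le rho c M ->
  norm_le rho (fun w => k * c w) (Normc.normc k * M).
Proof.
move=> hc J uJ; apply: le_trans (ler_wpM2l (normc_ge0 k) (hc J uJ)).
by rewrite mulr_sumr; apply: ler_sum => w _; rewrite Normc.normcM mulrA.
Qed.

Lemma free_entireP c :
  free_entire c <-> forall rho : R, 0 < rho -> exists M, norm_le rho c M.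
Proof.
split=> h rho r0.
  have := h rho r0.
  have ge0 w : (0 <= (Normc.normc (c w) * rho ^+ size w)%:E)%E.
    by rewrite lee_fin mulr_ge0 ?normc_ge0// exprn_ge0// ltW.
  have : (0 <= free_norm rho c)%E by apply: esum_ge0.
  case E : (free_norm rho c) => [M| |]// _ _; exists M => J uJ.
  rewrite -lee_fin -E -sumEFin; apply: esum_ge.
  exists [set` J]; last by rewrite fsbig_seq.
  by split=> //; exact: finite_seq.
have [M HM] := h rho r0.
apply: (@le_lt_trans _ _ M%:E); last exact: ltry.
apply: ge_ereal_sup => _ [A [finA _] <-].
by rewrite fsbig_finite//= sumEFin lee_fin; apply: HM; exact: fset_uniq.
Qed.

Lemma free_entire_linear k c d : free_entire c -> free_entire d ->
  free_entire (fun w => k * c w + d w).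
Proof.
move=> /free_entireP hc /free_entireP hd; apply/free_entireP => rho r0.
have [M HM] := hc _ r0; have [N HN] := hd _ r0.
by exists (Normc.normc k * M + N); apply: norm_leD (ltW r0) (norm_leZ k HM) HN.
Qed.

Lemma free_entire0 : free_entire (fun _ : word => 0 : R[i]).
Proof.
apply/free_entireP => rho _; exists 0 => J _; rewrite big1// => w _.
by rewrite Normc.normc0 mul0r.
Qed.

Lemma free_entire_sum (f : nat -> word -> R[i]) m :
  (forall j, free_entire (f j)) -> free_entire (fun w => \sum_(j < m) f j w).
Proof.
move=> hf; elim: m => [|m IH].
  have := free_entire0; congr free_entire.
  by apply/funext => w; rewrite big_ord0.
have := free_entire_linear (1) (hf m) IH; congr free_entire.
by apply/funext => w; rewrite big_ord_recr /= mul1r addrC.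
Qed.

Lemma free_entireB c d : free_entire c -> free_entire d ->
  free_entire (fun w => c w - d w).
Proof.
move=> hc hd; have := free_entire_linear (-1) hd hc; congr free_entire.
by apply/funext => w; rewrite mulN1r addrC.
Qed.

Definition restrict J c : word -> R[i] := fun w => if w \in J then c w else 0.

Lemma restrict_le rho J c M : 0 <= rho -> norm_le rho c M ->
  norm_le rho (restrict J c) M.
Proof.
move=> r0 hc K uK; apply: le_trans (hc K uK); apply: ler_sum => w _.
rewrite ler_wpM2r ?exprn_ge0// /restrict; case: ifP => // _.
by rewrite Normc.normc0 normc_ge0.
Qed.

(** Density of the finitely supported series: if a finite sum is within e of the
supremum of all of them, then what is left out sums to less than e. *)
Lemma norm_le_tail rho c e : 0 <= rho -> (exists M, norm_le rho c M) -> 0 < e ->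
  exists2 J, uniq J & norm_le rho (fun w => c w - restrict J c w) e.
Proof.
move=> r0 [M HM] e0.
pose S := [set \sum_(w <- J) Normc.normc (c w) * rho ^+ size w | J in [set J | uniq J]].
have supS : has_sup S.
  split; first by exists 0; exists [::] => //; rewrite big_nil.
  by exists M => _ [J uJ <-]; exact: HM.
have [_ [J /= uJ <-] HJ] := sup_adherent e0 supS.
exists J => // K uK.
pose K' := [seq w <- K | w \notin J].
have uJK : uniq (K' ++ J).
  rewrite cat_uniq uJ filter_uniq// andbT; apply/hasPn => w wJ.
  by rewrite mem_filter wJ.
have ub : \sum_(w <- K' ++ J) Normc.normc (c w) * rho ^+ size w <= sup S.
  by apply: sup_upper_bound => //; exists (K' ++ J).
rewrite big_cat /= in ub.
suff -> : \sum_(w <- K) Normc.normc (c w - restrict J c w) * rho ^+ size w =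
  \sum_(w <- K') Normc.normc (c w) * rho ^+ size w by lra.
rewrite big_filter [RHS]big_mkcond /=; apply: eq_bigr => w _.
rewrite /restrict; case: (w \in J) => /=; last by rewrite subr0.
by rewrite subrr Normc.normc0 mul0r.
Qed.

(** The concatenation product: the indices i enumerate the factorisations of w. *)
Definition conv c d : word -> R[i] :=
  fun w => \sum_(i < (size w).+1) c (take i w) * d (drop i w).

(** A word and a cutting position are recovered from the two factors, so the
terms of a finite sum for the product belong to distinct pairs of words, and such
a sum is part of a product of two finite sums. *)
Lemma norm_le_conv rho c d M N : 0 <= rho -> norm_le rho c M ->
  norm_le rho d N -> norm_le rho (conv c d) (M * N).
Proof.
move=> r0 hc hd J uJ.
pose L := [seq (take i w, drop i w) | w <- J, i <- iota 0 (size w).+1].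
pose f (u : word * word) := (Normc.normc (c u.1) * rho ^+ size u.1) *
  (Normc.normc (d u.2) * rho ^+ size u.2).
have f0 u : 0 <= f u by rewrite !mulr_ge0 ?normc_ge0 ?exprn_ge0.
have uL : uniq L.
  apply: allpairs_uniq_dep => //; first by move=> w _; exact: iota_uniq.
  move=> u u' /allpairsPdep [v [k [_ + ->]]] /allpairsPdep [v' [k' [_ + ->]]] /=.
  rewrite !mem_iota !add0n !ltnS => kv kv' [e1 e2].
  have vv : v = v' by rewrite -(cat_take_drop k v) e1 e2 cat_take_drop.
  subst v'; congr (Tagged _ _).
  by have := congr1 size e1; rewrite !size_takel.
apply: (@le_trans _ _ (\sum_(u <- L) f u)).
  rewrite /L big_allpairs_dep; apply: ler_sum => w _.
  have -> : iota 0 (size w).+1 = index_iota 0 (size w).+1 by rewrite /index_iota subn0.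
  rewrite big_mkord /conv.
  apply: (@le_trans _ _ ((\sum_(i < (size w).+1)
      Normc.normc (c (take i w) * d (drop i w))) * rho ^+ size w)).
    rewrite ler_wpM2r ?exprn_ge0//.
    elim/big_ind2 : _ => [|x x' y y' hx hy|//]; first by rewrite Normc.normc0.
    by apply: le_trans (le_normcD _ _) (lerD hx hy).
  rewrite mulr_suml; apply: ler_sum => i _; rewrite /f /= Normc.normcM.
  by rewrite mulrACA -exprD -size_cat cat_take_drop.
pose K1 := undup (map fst L); pose K2 := undup (map snd L).
apply: (@le_trans _ _ (\sum_(u <- allpairs pair K1 K2) f u)).
  have uK : uniq (allpairs pair K1 K2).
    by apply: allpairs_uniq; rewrite ?undup_uniq// => -[a b] [a' b'].
  have LK : {subset L <= allpairs pair K1 K2}.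
    move=> [a b] ab; apply: allpairs_f; rewrite mem_undup; apply/mapP; exists (a, b) => //.
  have <- : \sum_(u <- allpairs pair K1 K2 | u \in L) f u = \sum_(u <- L) f u.
    rewrite -big_filter; apply/perm_big/uniq_perm; rewrite ?filter_uniq// => u.
    by rewrite mem_filter; case uu: (u \in L) => //=; rewrite LK.
  rewrite big_mkcond /=; apply: ler_sum => u _; by case: ifP.
rewrite big_allpairs /f /=.
under eq_bigr do rewrite -mulr_sumr.
rewrite -mulr_suml; apply: ler_pM.
- by apply: sumr_ge0 => u _; rewrite mulr_ge0 ?normc_ge0 ?exprn_ge0.
- by apply: sumr_ge0 => u _; rewrite mulr_ge0 ?normc_ge0 ?exprn_ge0.
- exact/hc/undup_uniq.
- exact/hd/undup_uniq.
Qed.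

End FreeSeries.

Lemma normc_Re (R : rcfType) (z : R[i]) : `|complex.Re z| <= Normc.normc z.
Proof.
case: z => a b /=; rewrite -sqrtr_sqr ler_wsqrtr// lerDl sqr_ge0 //.
Qed.

Lemma normc_Im (R : rcfType) (z : R[i]) : `|complex.Im z| <= Normc.normc z.
Proof.
case: z => a b /=; rewrite -sqrtr_sqr ler_wsqrtr// lerDr sqr_ge0 //.
Qed.

Lemma normc_le_ReIm (R : rcfType) (z : R[i]) :
  Normc.normc z <= `|complex.Re z| + `|complex.Im z|.
Proof.
case: z => a b /=; rewrite -[leRHS]ger0_norm ?addr_ge0// -(sqrtr_sqr (`|a| + `|b|)).
rewrite ler_wsqrtr// sqrrD !real_normK ?num_real//.
by rewrite -addrA lerD2l lerDr mulrn_wge0// mulr_ge0.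
Qed.

Lemma fast_cvg_real (R : realType) (u : nat -> R) :
  (forall j, `|u j| <= 2^-1 ^+ j) -> cvgn (series u).
Proof.
move=> hu; apply: normed_cvg.
have geo : cvgn (series (fun j => 2^-1 ^+ j : R)).
  have -> : (fun j => 2^-1 ^+ j : R) = geometric 1 2^-1.
    by apply/funext => j; rewrite /geometric /= mul1r.
  by apply: is_cvg_geometric_series; rewrite ger0_norm// invf_lt1// ltr1n.
by apply: (series_le_cvg _ _ _ geo) => //= j; rewrite exprn_ge0.
Qed.

Lemma fast_cvg_complex (R : realType) (u : nat -> R[i]) :
  (forall j, Normc.normc (u j) <= 2^-1 ^+ j) ->
  exists l : R[i], forall e : R, 0 < e -> exists M, forall m, (M <= m)%N ->
    Normc.normc (l - \sum_(j < m) u j) < e.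
Proof.
move=> hu.
have /cvg_ex[/= a /cvgrPdist_lt ha] : cvgn (series (fun j => complex.Re (u j))).
  by apply: fast_cvg_real => j; exact: le_trans (normc_Re _) (hu j).
have /cvg_ex[/= b /cvgrPdist_lt hb] : cvgn (series (fun j => complex.Im (u j))).
  by apply: fast_cvg_real => j; exact: le_trans (normc_Im _) (hu j).
exists (a +i* b)%C => e e0; have e20 : 0 < e / 2 by rewrite divr_gt0.
have [M1 _ H1] := ha _ e20; have [M2 _ H2] := hb _ e20.
exists (maxn M1 M2) => m; rewrite geq_max => /andP[/H1 /= + /H2 /=].
rewrite /series /= !big_mkord => h1 h2.
apply: le_lt_trans (normc_le_ReIm _) _; rewrite (splitr e) ltrD//.
  rewrite raddfB /=; rewrite raddf_sum /=; exact: h1.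
by rewrite raddfB /= raddf_sum.
Qed.

Section FastSeries.
Variables (R : realType) (n : nat) (f : nat -> seq 'I_n -> R[i]).
Hypothesis f_entire : forall j, free_entire (f j).
Hypothesis f_small : forall j, norm_le j.+1%:R (f j) (2^-1 ^+ j).

Lemma norm_le_partial N m k : (N <= m)%N ->
  norm_le N.+1%:R (fun w => \sum_(j < k + m) f j w - \sum_(j < m) f j w)
    (2 * 2^-1 ^+ m - 2 * 2^-1 ^+ (k + m)).
Proof.
move=> Nm; elim: k => [|k IH].
  move=> J _; rewrite add0n subrr big1// => w _.
  by rewrite subrr Normc.normc0 mul0r.
have h : norm_le N.+1%:R (f (k + m)%N) (2^-1 ^+ (k + m)).
  apply: norm_le_radius (f_small _) => //; rewrite ler_nat ltnS.
  exact: leq_trans Nm (leq_addl _ _).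
have := norm_leD _ IH h; move=> /(_ (ler0n _ _)) {}h J uJ.
apply: (@le_trans _ _ (2 * 2^-1 ^+ m - 2 * 2^-1 ^+ (k + m) + 2^-1 ^+ (k + m))).
  apply: le_trans (h J uJ); apply: ler_sum => w _.
  by rewrite addSn big_ord_recr /= addrAC.
by rewrite addSn exprS mulrA divff// mul1r; lra.
Qed.

(** Completeness of the algebra of free entire series. The sum is computed
coefficientwise, and its tails are bounded by lower semicontinuity: a finite
partial sum only involves finitely many coefficients, hence is approximated by
the finite sums of the f j. *)
Lemma fast_series : exists2 c : seq 'I_n -> R[i], free_entire c &
  forall N m, (N <= m)%N ->
    norm_le N.+1%:R (fun w => c w - \sum_(j < m) f j w) (2 * 2^-1 ^+ m).
Proof.
have /choice [c hc] : forall w : seq 'I_n, exists l : R[i], forall e : R, 0 < e ->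
    exists M, forall m, (M <= m)%N -> Normc.normc (l - \sum_(j < m) f j w) < e.
  move=> w; apply: (@fast_cvg_complex R (fun j => f j w)) => j.
  have /= := f_small j (J := [:: w]) isT; rewrite big_seq1; apply: le_trans.
  by rewrite ler_peMr ?normc_ge0// exprn_ege1// ler1n.
have near (rho : R) J e : 0 <= rho -> 0 < e -> exists M, forall m, (M <= m)%N ->
    \sum_(w <- J) Normc.normc (c w - \sum_(j < m) f j w) * rho ^+ size w <= e.
  move=> r0; elim: J e => [|w J IH] e e0.
    by exists 0%N => m _; rewrite big_nil ltW.
  have e20 : 0 < e / 2 by rewrite divr_gt0.
  have [M1 H1] := IH _ e20.
  have r1 : 0 < rho ^+ size w + 1 by rewrite ltr_wpDl// exprn_ge0.
  have [|M2 H2] := hc w (e / 2 / (rho ^+ size w + 1)); first by rewrite divr_gt0.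
  exists (maxn M1 M2) => m; rewrite geq_max => /andP[/H1 h1 /H2 h2].
  rewrite big_cons (splitr e) lerD//.
  move: h2; rewrite ltr_pdivlMr// => /ltW; apply: le_trans.
  by rewrite ler_wpM2l ?normc_ge0// lerDl.
have bnd N m : (N <= m)%N ->
    norm_le N.+1%:R (fun w => c w - \sum_(j < m) f j w) (2 * 2^-1 ^+ m).
  move=> Nm J uJ; apply/ler_addgt0Pr => e e0.
  have [M HM] := near N.+1%:R J e (ler0n _ _) e0.
  have := HM _ (leq_addr m M) => h1.
  have h2 := norm_le_partial M Nm uJ.
  have h3 : 0 <= 2 * 2^-1 ^+ (M + m) :> R by rewrite mulr_ge0// exprn_ge0.
  apply: (@le_trans _ _ (e + (2 * 2^-1 ^+ m - 2 * 2^-1 ^+ (M + m)))); last by lra.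
  apply: le_trans (lerD h1 h2); rewrite -big_split /=; apply: ler_sum => w _.
  rewrite -mulrDl ler_wpM2r ?exprn_ge0//.
  rewrite -[X in Normc.normc X <= _](subrKA (\sum_(j < M + m) f j w)).
  exact: le_normcD.
exists c => //; apply/free_entireP => rho r0.
pose N := Num.truncn rho.
have rN : rho <= N.+1%:R by apply/ltW; rewrite truncnS_gt.
have [M HM] := (free_entireP _).1 (free_entire_sum N f_entire) _ r0.
exists (2 * 2^-1 ^+ N + M) => J uJ.
have := norm_leD (ltW r0) (norm_le_radius (ltW r0) rN (bnd N N (leqnn N))) HM uJ.
by apply: le_trans; apply: ler_sum => w _; rewrite subrK.
Qed.

End FastSeries.

Section EntireClosure.
Variables (R : realType) (n : nat).
Local Notation word := (seq 'I_n).
Implicit Types (c d : word -> R[i]).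

Lemma free_entire_conv c d : free_entire c -> free_entire d ->
  free_entire (conv c d).
Proof.
move=> /free_entireP hc /free_entireP hd; apply/free_entireP => rho r0.
have [M HM] := hc _ r0; have [N HN] := hd _ r0.
by exists (M * N); apply: norm_le_conv (ltW r0) HM HN.
Qed.

Lemma free_entire_delta (u : word) : free_entire (fun w : word => (u == w)%:R : R[i]).
Proof.
apply/free_entireP => rho r0; exists (rho ^+ size u) => J uJ.
have [uinJ|uJ'] := boolP (u \in J).
  rewrite (bigD1_seq u)//= big1 => [|w /negbTE wu].
    by rewrite eqxx addr0 -[1%:R]/(1%C) Normc.normc1 mul1r.
  by rewrite eq_sym wu Normc.normc0 mul0r.
rewrite big1_seq ?exprn_ge0 ?ltW// => w /andP[_ wJ].
have -> : (u == w) = false by apply: contraNF uJ' => /eqP ->.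
by rewrite Normc.normc0 mul0r.
Qed.

Lemma restrict_sum (J : seq word) c w : uniq J ->
  restrict J c w = \sum_(u <- J) c u * (u == w)%:R.
Proof.
move=> uJ; rewrite /restrict; case: ifPn => wJ.
  rewrite (bigD1_seq w)//= eqxx mulr1 big1 ?addr0// => u /negbTE ->.
  by rewrite mulr0.
rewrite big1_seq// => u /andP[_ uinJ].
by rewrite (_ : (u == w) = false) ?mulr0//; apply: contraNF wJ => /eqP <-.
Qed.

Lemma sum_factorizations (u v w : word) :
  \sum_(i < (size w).+1) (u == take i w)%:R * (v == drop i w)%:R
  = (u ++ v == w)%:R :> R[i].
Proof.
have [<-|uvw] := eqVneq (u ++ v) w.
  have hu : (size u < (size (u ++ v)).+1)%N by rewrite size_cat ltnS leq_addr.
  rewrite (bigD1 (Ordinal hu))//= take_size_cat// drop_size_cat// !eqxx mulr1.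
  rewrite big1 ?addr0// => i iu.
  have [ui|] := eqVneq u (take i (u ++ v)); last by rewrite mul0r.
  case/eqP: iu; apply: val_inj => /=; rewrite {2}ui size_takel//.
  by rewrite -ltnS.
rewrite big1// => i _; have [ui|] := eqVneq u (take i w); last by rewrite mul0r.
have [vi|] := eqVneq v (drop i w); last by rewrite mulr0.
by case/eqP: uvw; rewrite ui vi cat_take_drop.
Qed.

Lemma conv_restrict (J K : seq word) c d w : uniq J -> uniq K ->
  conv (restrict J c) (restrict K d) w =
  \sum_(u <- J) \sum_(v <- K) c u * d v * (u ++ v == w)%:R.
Proof.
move=> uJ uK; rewrite /conv.
under eq_bigr => i _.
  rewrite (restrict_sum _ _ uJ) (restrict_sum _ _ uK) big_distrlr /=.
  over.
rewrite exchange_big /=; apply: eq_bigr => u _.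
rewrite exchange_big /=; apply: eq_bigr => v _.
rewrite -sum_factorizations mulr_sumr; apply: eq_bigr => i _.
by rewrite mulrACA.
Qed.

End EntireClosure.

(** * Evaluation of free entire series *)

Instance finite_subsets_filter_proper (I : choiceType) :
  ProperFilter (finite_subsets_filter I).
Proof.
apply: filter_from_proper; last by move=> J _; exists J => /=; exact: fsubset_refl.
apply: filter_from_filter; first by exists fset0.
move=> J K _ _; exists (J `|` K)%fset => // L /= JKL; split.
  by apply: fsubset_trans JKL; exact: fsubsetUl.
by apply: fsubset_trans JKL; exact: fsubsetUr.
Qed.

Section Evaluation.
Variables (R : realType) (A : topAlgType R[i]) (n : nat) (a : 'I_n -> A).
Local Notation word := (seq 'I_n).
Implicit Types (c d : word -> R[i]) (w : word).

Definition monomial w : A := \prod_(i <- w) a i.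

Definition partial_sum c (J : {fset word}) : A :=
  \sum_(w <- J) c w *: monomial w.

Definition evaluates c (x : A) := partial_sum c @ finite_subsets_filter word --> x.

Lemma monomial_cat u v : monomial (u ++ v) = monomial u * monomial v.
Proof. exact: big_cat. Qed.

Lemma partial_sumD k c d J : partial_sum (fun w => k * c w + d w) J =
  k *: partial_sum c J + partial_sum d J.
Proof.
rewrite /partial_sum scaler_sumr -big_split /=; apply: eq_bigr => w _.
by rewrite scalerDl scalerA.
Qed.

Lemma partial_sum_support c (J : seq word) (K : {fset word}) :
  uniq J -> (forall w, w \notin J -> c w = 0) -> {subset J <= K} ->
  partial_sum c K = \sum_(w <- J) c w *: monomial w.
Proof.
move=> uJ cJ JK; rewrite /partial_sum (big_fsetID _ (mem J)) /=.
rewrite [X in _ + X]big1_seq ?addr0; last first.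
  by move=> w /andP[_]; rewrite !inE /= => /andP[_ /cJ ->]; rewrite scale0r.
apply: perm_big; apply: uniq_perm => //; first exact: fset_uniq.
by move=> w; rewrite !inE /= andbC; case wJ: (w \in J) => //=; exact: JK.
Qed.

(** Partial sums of a finitely supported series are eventually constant. *)
Lemma evaluates_finite c (J : seq word) : uniq J -> (forall w, w \notin J -> c w = 0) ->
  evaluates c (\sum_(w <- J) c w *: monomial w).
Proof.
move=> uJ cJ; apply: cvg_near_cst.
exists [fset w in J]%fset => // K /= JK.
by apply: partial_sum_support => // w wJ; apply: (fsubsetP JK); rewrite !inE.
Qed.

Variable Q : set (A -> R).
Hypotheses (semQ : Q `<=` @seminorm R A) (mulQ : Q `<=` @submultiplicative R A)
  (topQ : topology_defined_by Q) (hausA : hausdorff_space A)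
  (complA : complete_space A).

(** The factor [p 1] accounts for the empty word: it may exceed 1,
as a submultiplicative seminorm need not be normalised. *)
Lemma monomial_le p rho w : Q p -> (forall i, p (a i) <= rho) ->
  p (monomial w) <= p 1 * rho ^+ size w.
Proof.
move=> Qp ha; have semp := semQ Qp; rewrite /monomial.
elim: w => [|i w IH]; first by rewrite big_nil expr0 mulr1.
rewrite big_cons (le_trans (mulQ Qp _ _))// exprS mulrCA.
by apply: ler_pM => //; exact: seminorm_ge0.
Qed.

Lemma partial_sum_le p rho c M J : Q p -> (forall i, p (a i) <= rho) ->
  norm_le rho c M -> p (partial_sum c J) <= p 1 * M.
Proof.
move=> Qp ha hc; have semp := semQ Qp.
apply: le_trans (seminorm_sum semp _ _) _.
apply: le_trans (ler_wpM2l (seminorm_ge0 semp _) (hc J (fset_uniq J))).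
rewrite mulr_sumr; apply: ler_sum => w _.
by rewrite seminormZ// mulrCA ler_wpM2l ?normc_ge0// monomial_le.
Qed.

Lemma gauge_radius p : Q p -> exists2 rho, 0 < rho & forall i, p (a i) <= rho.
Proof.
move=> Qp; have semp := semQ Qp; exists (1 + \sum_i p (a i)).
  by rewrite ltr_pwDl// sumr_ge0// => i _; exact: seminorm_ge0.
move=> i; rewrite (bigD1 i)//= addrCA lerDl addr_ge0// sumr_ge0// => j _.
exact: seminorm_ge0.
Qed.

(** Partial sums over supersets of J differ from the sum over J by at most
p 1 times the norm of the tail outside J, so their net is Cauchy. *)
Lemma evaluates_exists c : free_entire c -> exists x, evaluates c x.
Proof.
move=> /free_entireP hc.
apply: (gauge_cauchy topQ) => // p e Qp e0; have semp := semQ Qp.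
have [rho r0 ha] := gauge_radius Qp.
have p1 : 0 < p 1 + 1 by rewrite ltr_wpDl// seminorm_ge0.
have [|J uJ HJ] := norm_le_tail (ltW r0) (hc _ r0) (e := e / 2 / (p 1 + 1)).
  by rewrite !divr_gt0.
have key (K : {fset word}) : {subset J <= K} ->
    p (partial_sum c K - \sum_(w <- J) c w *: monomial w) < e / 2.
  move=> JK; have := partial_sum_le K Qp ha HJ.
  have -> : partial_sum (fun w => c w - restrict J c w) K =
      partial_sum c K - \sum_(w <- J) c w *: monomial w.
    transitivity (partial_sum c K - partial_sum (restrict J c) K).
      by rewrite /partial_sum -sumrB; apply: eq_bigr => w _; rewrite scalerBl.
    congr (_ - _); rewrite (partial_sum_support uJ _ JK).
      by apply: eq_big_seq => w wJ; rewrite /restrict wJ.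
    by move=> w /negbTE wJ; rewrite /restrict wJ.
  move=> h; apply: le_lt_trans h _; rewrite mulrCA gtr_pMr ?divr_gt0//.
  by rewrite ltr_pdivrMr// mul1r ltrDl.
exists [set partial_sum c K | K in [set K : {fset word} | {subset J <= K}]].
  exists [fset w in J]%fset => // K /= JK; exists K => // w wJ.
  by apply: (fsubsetP JK); rewrite !inE.
move=> _ _ [K /= JK <-] [L /= JL <-].
apply: le_lt_trans (seminorm_dist semp (\sum_(w <- J) c w *: monomial w) _ _) _.
by rewrite (splitr e) ltrD//; [exact: key|rewrite seminormB//; exact: key].
Qed.

Lemma evaluates_unique c x y : evaluates c x -> evaluates c y -> x = y.
Proof. by apply: cvg_unique. Qed.

Lemma evaluates_eq c x : evaluates c x -> free_eval c a = x.
Proof. by move=> h; apply: xget_unique => // y hy; apply: evaluates_unique h. Qed.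

Lemma evaluates_free_eval c : free_entire c -> evaluates c (free_eval c a).
Proof.
by move=> /evaluates_exists [x hx]; rewrite (evaluates_eq hx).
Qed.

Lemma evaluates_linear k c d x y : evaluates c x -> evaluates d y ->
  evaluates (fun w => k * c w + d w) (k *: x + y).
Proof.
move=> hc hd; rewrite /evaluates.
rewrite (_ : partial_sum _ = (fun J => k *: partial_sum c J + partial_sum d J)).
  have hk : (fun J => k *: partial_sum c J) @ finite_subsets_filter word --> k *: x.
    apply: (@continuous2_cvg _ R[i]^o A A _ _ (cst k) _ (fun u v => u *: v) k) hc.
      exact: (scale_continuous ((k : R[i]^o), x)).
    exact: cvg_cst.
  apply: (@continuous2_cvg _ A A A _ _ _ _ (fun u v => u + v)) hk hd.
  exact: (add_continuous (k *: x, y)).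
by apply/funext => J; exact: partial_sumD.
Qed.

Lemma evaluates_le p rho c x M : Q p -> (forall i, p (a i) <= rho) ->
  norm_le rho c M -> evaluates c x -> p x <= p 1 * M.
Proof.
move=> Qp ha hc hx; have semp := semQ Qp.
apply/ler_addgt0Pr => e e0.
have /hx [J _ HJ] := gauge_nbhs topQ x Qp e0.
have /= h := HJ J (fsubset_refl J).
have := partial_sum_le J Qp ha hc.
have := seminormD semp (partial_sum c J) (x - partial_sum c J).
by rewrite [X in p X <= _]addrC subrK seminormB//; lra.
Qed.

End Evaluation.

Section EvaluationMorphism.
Variables (R : realType) (A : topAlgType R[i]) (n : nat) (a : 'I_n -> A).
Variable Q : set (A -> R).
Hypotheses (semQ : Q `<=` @seminorm R A) (mulQ : Q `<=` @submultiplicative R A)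
  (topQ : topology_defined_by Q) (hausA : hausdorff_space A)
  (complA : complete_space A).
Local Notation word := (seq 'I_n).
Implicit Types (c d : word -> R[i]) (w : word).

Lemma evaluates0 : evaluates a (fun=> 0) 0.
Proof.
have := @evaluates_finite R A n a (fun=> 0) [::] isT (fun _ _ => erefl).
by rewrite big_nil.
Qed.

Lemma evaluates_delta (u : word) : evaluates a (fun w : word => (u == w)%:R) (monomial a u).
Proof.
have := @evaluates_finite R A n a (fun w => (u == w)%:R) [:: u] isT.
rewrite big_seq1 eqxx scale1r; apply => w; rewrite inE eq_sym.
by move=> /negbTE ->.
Qed.

Lemma evaluates_sum (I : Type) (s : seq I) (k : I -> R[i])
    (c : I -> word -> R[i]) (x : I -> A) : (forall i, evaluates a (c i) (x i)) ->
  evaluates a (fun w => \sum_(i <- s) k i * c i w) (\sum_(i <- s) k i *: x i).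
Proof.
move=> hc; elim: s => [|i s IH].
  rewrite big_nil (_ : (fun w => _) = (fun=> 0)); first exact: evaluates0.
  by apply/funext => w; rewrite big_nil.
rewrite big_cons (_ : (fun w => _) =
  (fun w => k i * c i w + \sum_(i <- s) k i * c i w)); last first.
  by apply/funext => w; rewrite big_cons.
exact: evaluates_linear.
Qed.

Lemma evaluates_conv_restrict (J K : seq word) c d : uniq J -> uniq K ->
  evaluates a (conv (restrict J c) (restrict K d))
    ((\sum_(u <- J) c u *: monomial a u) * (\sum_(v <- K) d v *: monomial a v)).
Proof.
move=> uJ uK.
rewrite (_ : conv _ _ = (fun w =>
  \sum_(u <- J) c u * \sum_(v <- K) d v * (u ++ v == w)%:R)); last first.
  apply/funext => w; rewrite conv_restrict//; apply: eq_bigr => u _.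
  by rewrite mulr_sumr; apply: eq_bigr => v _; rewrite mulrA.
rewrite mulr_suml.
under eq_bigr => u _.
  rewrite -[_ * _]/(topalg_mul _ _) -topalg_scaleAl.
  rewrite [topalg_mul _ _](_ : _ = \sum_(v <- K) d v *: monomial a (u ++ v)); last first.
    rewrite -[LHS]/(_ * _) mulr_sumr; apply: eq_bigr => v _.
    by rewrite monomial_cat; rewrite [RHS]topalg_scaleAr.
  over.
apply: evaluates_sum => u; apply: evaluates_sum => v.
exact: evaluates_delta.
Qed.

Lemma evaluates_restrict (J : seq word) c : uniq J ->
  evaluates a (restrict J c) (\sum_(u <- J) c u *: monomial a u).
Proof.
move=> uJ; rewrite (_ : restrict J c = (fun w => \sum_(u <- J) c u * (u == w)%:R)).
  by apply: evaluates_sum => u; exact: evaluates_delta.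
by apply/funext => w; rewrite restrict_sum.
Qed.

Lemma evaluatesB c d x y : evaluates a c x -> evaluates a d y ->
  evaluates a (fun w => c w - d w) (x - y).
Proof.
move=> hc hd; have := evaluates_linear (k := -1) hd hc.
rewrite scaleN1r addrC; congr (evaluates _ _ _).
by apply/funext => w; rewrite mulN1r addrC.
Qed.

(** Evaluation is multiplicative on finitely supported series, which are dense,
and both sides depend continuously on the two series. *)
Lemma evaluates_conv c d x y : free_entire c -> free_entire d ->
  evaluates a c x -> evaluates a d y -> evaluates a (conv c d) (x * y).
Proof.
move=> ec ed hx hy.
have [z hz] := evaluates_exists a semQ mulQ topQ complA (free_entire_conv ec ed).
suff -> : x * y = z by [].
apply/eqP; rewrite -subr_eq0; apply/eqP.
apply: (gauge_separated semQ topQ hausA) => p Qp; have semp := semQ Qp.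
have [rho r0 ha] := gauge_radius a semQ Qp.
have [M HM] := (free_entireP c).1 ec _ r0.
have [N HN] := (free_entireP d).1 ed _ r0.
have M0 := norm_le_ge0 HM; have N0 := norm_le_ge0 HN.
have p10 : 0 <= p 1 by exact: seminorm_ge0.
apply/eqP; rewrite eq_le seminorm_ge0// andbT.
apply/ler_addgt0Pr => e e0; rewrite add0r.
(* e / C bounds the tails of c and d; C - 1 collects what multiplies it below *)
pose C := p 1 * (M + N) + p 1 * N * p 1 + p 1 * M * p 1 + 1.
have C0 : 0 < C by rewrite /C ltr_wpDl// !addr_ge0// !mulr_ge0// addr_ge0.
have e1 : 0 < e / C by rewrite divr_gt0.
have [J uJ HJ] := norm_le_tail (ltW r0) (ex_intro _ M HM) e1.
have [K uK HK] := norm_le_tail (ltW r0) (ex_intro _ N HN) e1.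
have hxJ := @evaluates_restrict J c uJ; have hyK := @evaluates_restrict K d uK.
set xJ := (\sum_(u <- J) _) in hxJ; set yK := (\sum_(v <- K) _) in hyK.
have hzJK := @evaluates_conv_restrict J K c d uJ uK.
rewrite -/xJ -/yK in hzJK.
have b1 : p (x - xJ) <= p 1 * (e / C).
  by apply: (evaluates_le semQ mulQ topQ Qp ha HJ); exact: evaluatesB.
have b2 : p (y - yK) <= p 1 * (e / C).
  by apply: (evaluates_le semQ mulQ topQ Qp ha HK); exact: evaluatesB.
have b3 : p y <= p 1 * N by apply: (evaluates_le semQ mulQ topQ Qp ha HN).
have HJM := restrict_le J (ltW r0) HM.
have b4 : p xJ <= p 1 * M by apply: (evaluates_le semQ mulQ topQ Qp ha HJM).
have b5 : p (z - xJ * yK) <= p 1 * (e / C * N + M * (e / C)).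
  apply: (evaluates_le semQ mulQ topQ Qp ha _ (evaluatesB hz hzJK)).
  have := norm_leD (ltW r0) (norm_le_conv (ltW r0) HJ HN) (norm_le_conv (ltW r0) HJM HK).
  congr (norm_le _ _ _); apply/funext => w.
  rewrite /conv -big_split -sumrB; apply: eq_bigr => i _ /=.
  by rewrite mulrBl mulrBr addrA subrK.
have b6 : p (x * y - xJ * yK) <= p (x - xJ) * p y + p xJ * p (y - yK).
  have -> : x * y - xJ * yK = (x - xJ) * y + xJ * (y - yK).
    by rewrite mulrBl mulrBr addrA subrK.
  by apply: le_trans (seminormD semp _ _) _; rewrite lerD// mulQ.
apply: le_trans (seminorm_dist semp (xJ * yK) _ _) _.
rewrite [X in _ + X]seminormB//.
apply: le_trans (lerD b6 b5) _.
have b7 : p (x - xJ) * p y <= p 1 * (e / C) * (p 1 * N).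
  by apply: ler_pM => //; exact: seminorm_ge0.
have b8 : p xJ * p (y - yK) <= p 1 * M * (p 1 * (e / C)).
  by apply: ler_pM => //; exact: seminorm_ge0.
apply: le_trans (lerD (lerD b7 b8) (lexx _)) _.
have -> : p 1 * (e / C) * (p 1 * N) + p 1 * M * (p 1 * (e / C)) +
   p 1 * (e / C * N + M * (e / C)) = (e / C) * (C - 1) by rewrite /C; ring.
by rewrite mulrBr divfK ?gt_eqF// mulr1 gerBl ltW.
Qed.

End EvaluationMorphism.

(** * Subalgebras with a finer seminormed topology *)

(** Meant for a subalgebra of P with a complete topology finer than the induced
one. The seminorms are total functions, which spares dependent types, but obey
their laws only on the subalgebra; homogeneity is stated as an inequality because
the converse follows by scaling back. *)
Record seminormed_subalgebra (R : realType) (P : topAlgType R[i]) := {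
  ssa_set : set P ;
  ssa_q : nat -> P -> R ;
  ssa_subalgebra : subalgebra ssa_set ;
  ssa_ge0 : forall N x, 0 <= ssa_q N x ;
  ssa_leD : forall N x y, ssa_set x -> ssa_set y ->
    ssa_q N (x + y) <= ssa_q N x + ssa_q N y ;
  ssa_leZ : forall N (k : R[i]) x, ssa_set x ->
    ssa_q N (k *: x) <= Normc.normc k * ssa_q N x ;
  ssa_leM : forall N x y, ssa_set x -> ssa_set y ->
    ssa_q N (x * y) <= ssa_q N x * ssa_q N y ;
  ssa_leS : forall N x, ssa_set x -> ssa_q N x <= ssa_q N.+1 x
}.

Section Carrier.
Variables (R : realType) (P : topAlgType R[i]) (D : seminormed_subalgebra P).

Definition ssa_pred : {pred P} := fun x => `[< ssa_set D x >].

Lemma ssa_predP x : reflect (ssa_set D x) (x \in ssa_pred).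
Proof. exact: asboolP. Qed.

Lemma ssa_submod_closed : submod_closed ssa_pred.
Proof.
have [h1 hlin _] := ssa_subalgebra D; split.
  apply/ssa_predP; have := hlin (-1) 1 1 h1 h1.
  by rewrite scaleN1r addNr.
by move=> k x y /ssa_predP hx /ssa_predP hy; apply/ssa_predP/hlin.
Qed.

HB.instance Definition _ := GRing.isSubmodClosed.Build R[i] P ssa_pred
  ssa_submod_closed.

(** A type of its own, so that it can bear a topology different from the one
induced by P. *)
Record ssa_car := SsaCar { ssa_val : P ; _ : ssa_val \in ssa_pred }.
HB.instance Definition _ := [isSub for ssa_val].
HB.instance Definition _ := [Choice of ssa_car by <:].
HB.instance Definition _ := [SubChoice_isSubLmodule of ssa_car by <:].

Local Notation car := ssa_car.

Definition ssa_norm (N : nat) (x : car) : R := ssa_q D N (ssa_val x).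

Lemma ssa_valP (x : car) : ssa_set D (ssa_val x).
Proof. by apply/ssa_predP; case: x. Qed.

Lemma ssa_val_linear : linear (@ssa_val : car -> P).
Proof. by move=> k x y; exact: (linearP (\val : car -> P)). Qed.

Lemma ssa_norm_ge0 N x : 0 <= ssa_norm N x. Proof. exact: ssa_ge0. Qed.

Lemma ssa_normD N x y : ssa_norm N (x + y) <= ssa_norm N x + ssa_norm N y.
Proof. apply: ssa_leD; exact: ssa_valP. Qed.

Lemma ssa_normZ N k x : ssa_norm N (k *: x) = Normc.normc k * ssa_norm N x.
Proof.
have le k' y : ssa_norm N (k' *: y) <= Normc.normc k' * ssa_norm N y.
  by apply: ssa_leZ; exact: ssa_valP.
apply/eqP; rewrite eq_le le /=.
have [->|k0] := eqVneq k 0; first by rewrite Normc.normc0 mul0r ssa_norm_ge0.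
have nk0 : 0 < Normc.normc k.
  rewrite lt_def; apply/andP; split; last by exact: normc_ge0.
  by apply: contra k0 => /eqP/Normc.eq0_normc ->.
have := le k^-1 (k *: x); rewrite scalerA mulVf// scale1r Normc.normcV.
by rewrite ler_pdivlMl.
Qed.

Lemma ssa_norm0 N : ssa_norm N 0 = 0.
Proof. by rewrite -(scale0r 0) ssa_normZ Normc.normc0 mul0r. Qed.

Lemma ssa_normN N x : ssa_norm N (- x) = ssa_norm N x.
Proof.
by rewrite -scaleN1r ssa_normZ normcN1 mul1r.
Qed.

Lemma ssa_normB N x y : ssa_norm N (x - y) = ssa_norm N (y - x).
Proof. by rewrite -opprB ssa_normN. Qed.

Lemma ssa_normT N y x z :
  ssa_norm N (x - z) <= ssa_norm N (x - y) + ssa_norm N (y - z).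
Proof. by rewrite (_ : x - z = (x - y) + (y - z)) ?ssa_normD// subrKA. Qed.

Lemma ssa_norm_le N M x : (N <= M)%N -> ssa_norm N x <= ssa_norm M x.
Proof.
move=> /subnK <-; elim: (M - N)%N => // k; rewrite addSn => /le_trans; apply.
exact/ssa_leS/ssa_valP.
Qed.

Definition ssa_ent : set_system (car * car) := [set E | exists N (e : R),
  0 < e /\ forall x y, ssa_norm N (y - x) < e -> E (x, y)].

Lemma ssa_ent_filter : Filter ssa_ent.
Proof.
split; first by exists 0%N, 1.
  move=> E F [N [e [e0 He]]] [M [d [d0 Hd]]].
  exists (maxn N M), (Num.min e d); split; first by rewrite lt_min e0.
  move=> x y; rewrite lt_min => /andP[h1 h2]; split.
    by apply: He; apply: le_lt_trans h1; apply/ssa_norm_le/leq_maxl.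
  by apply: Hd; apply: le_lt_trans h2; apply/ssa_norm_le/leq_maxr.
by move=> E F EF [N [e [e0 He]]]; exists N, e; split=> // x y /He/EF.
Qed.

Lemma ssa_ent_diag E : ssa_ent E -> (diagonal `<=` E)%classic.
Proof.
by move=> [N [e [e0 He]]] [x y]; rewrite /diagonal /= => <-; apply: He; rewrite subrr ssa_norm0.
Qed.

Lemma ssa_ent_inv E : ssa_ent E -> ssa_ent (E^-1)%relation.
Proof.
move=> [N [e [e0 He]]]; exists N, e; split=> // x y h.
by apply: He; rewrite ssa_normB.
Qed.

Lemma ssa_ent_split E : ssa_ent E ->
  exists2 F, ssa_ent F & (F \; F `<=` E)%relation.
Proof.
move=> [N [e [e0 He]]].
exists [set z | ssa_norm N (z.2 - z.1) < e / 2].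
  by exists N, (e / 2); split=> //; rewrite divr_gt0.
move=> [x y] [z /= xz zy]; apply: He.
by rewrite (le_lt_trans (ssa_normT N z _ _))// (splitr e) ltrD.
Qed.

HB.instance Definition _ := isUniform.Build car
  ssa_ent_filter ssa_ent_diag ssa_ent_inv ssa_ent_split.

Lemma ssa_nbhsP (x : car) (U : set car) : nbhs x U <->
  exists N (e : R), 0 < e /\ forall y, ssa_norm N (y - x) < e -> U y.
Proof.
split.
  move=> [E [N [e [e0 He]]] EU]; exists N, e; split=> // y /He h.
  exact/EU/xsectionP.
move=> [N [e [e0 He]]]; exists [set z | ssa_norm N (z.2 - z.1) < e].
  by exists N, e.
by move=> y /xsectionP /= /He.
Qed.

Lemma ssa_nbhs_ball x N (e : R) : 0 < e -> nbhs x [set y | ssa_norm N (y - x) < e].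
Proof. by move=> e0; apply/ssa_nbhsP; exists N, e. Qed.

Lemma ssa_add_unif : unif_continuous (fun z : car * car => z.1 + z.2).
Proof.
move=> E [N [e [e0 He]]].
pose F := [set z : car * car | ssa_norm N (z.2 - z.1) < e / 2].
have FE : ssa_ent F by exists N, (e / 2); split=> //; rewrite divr_gt0.
exists (F, F); first by split.
move=> [[a b] [c d]] /= [h1 h2]; exists ((a, c), (b, d)) => //=.
apply: He; rewrite opprD addrACA (le_lt_trans (ssa_normD _ _ _))//.
by rewrite (splitr e) ltrD.
Qed.

Lemma ssa_add_continuous : continuous (fun z : car * car => z.1 + z.2).
Proof.
move=> [x y] U /ssa_nbhsP [N [e [e0 He]]].
have e20 : 0 < e / 2 by rewrite divr_gt0.
exists ([set z | ssa_norm N (z - x) < e / 2], [set z | ssa_norm N (z - y) < e / 2]).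
  by split; exact: ssa_nbhs_ball.
move=> [a b] /= [h1 h2]; apply: He.
rewrite opprD addrACA (le_lt_trans (ssa_normD _ _ _))//.
by rewrite (splitr e) ltrD.
Qed.
HB.instance Definition _ :=
  PreTopologicalNmodule_isTopologicalNmodule.Build car ssa_add_continuous.

Lemma normc_lt (k : R[i]) (e : R) : `|k| < (e%:C)%C -> Normc.normc k < e.
Proof. by case: k => a b; rewrite normc_def /= ltcR. Qed.

Lemma ssa_scale_continuous :
  continuous (fun z : R[i]^o * car => z.1 *: z.2).
Proof.
move=> [k x] U /ssa_nbhsP [N [e [e0 He]]].
pose m := Normc.normc k + 1 + ssa_norm N x.
have nk : 0 <= Normc.normc k by exact: normc_ge0.
have m0 : 0 < m by rewrite /m -addrA addrCA ltr_pwDl// addr_ge0// ssa_norm_ge0.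
pose d := Num.min 1 (e / (m + m)).
have mm0 : 0 < m + m by rewrite addr_gt0.
have d0 : 0 < d by rewrite lt_min ltr01 divr_gt0.
exists ([set z : R[i]^o | `|k - z| < (d%:C)%C], [set z | ssa_norm N (z - x) < d]).
  split; last exact: ssa_nbhs_ball.
  by apply: (nbhsx_ballx (k : R[i]^o) (d%:C)%C); rewrite ltcR.
move=> [l y] /= [h1 h2]; apply: He.
have {}h1 : Normc.normc (l - k) < d by apply: normc_lt; rewrite distrC.
have -> : l *: y - k *: x = l *: (y - x) + (l - k) *: x.
  by rewrite scalerBr scalerBl addrA subrK.
apply: le_lt_trans (ssa_normD _ _ _) _; rewrite !ssa_normZ.
have hl : Normc.normc l <= Normc.normc k + 1.
  have -> : l = k + (l - k) by rewrite addrC subrK.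
  apply: le_trans (le_normcD _ _) _; rewrite lerD2l.
  by apply/ltW/(lt_le_trans h1); rewrite /d ge_min lexx.
have hm1 : Normc.normc k + 1 <= m by rewrite /m lerDl ssa_norm_ge0.
have hm2 : ssa_norm N x <= m by rewrite /m lerDr addr_ge0.
have dm : d * (m + m) <= e.
  by rewrite -ler_pdivlMr// /d ge_min lexx orbT.
apply: lt_le_trans dm; rewrite mulrDr ltr_leD//.
  apply: (@le_lt_trans _ _ (m * ssa_norm N (y - x))).
    by rewrite ler_wpM2r ?ssa_norm_ge0// (le_trans hl).
  by rewrite mulrC ltr_pM2r.
by apply: ler_pM => //; [exact: normc_ge0|exact: ssa_norm_ge0|exact: ltW].
Qed.
HB.instance Definition _ :=
  TopologicalNmodule_isTopologicalLmodule.Build R[i] car ssa_scale_continuous.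
Local Open Scope convex_scope.
Lemma ssa_locally_convex :
  exists2 B : set_system car, (forall b, b \in B -> convex_set b) & basis B.
Proof.
exists [set B | exists x N (e : R), B = [set y | ssa_norm N (y - x) < e]].
  move=> B /[!inE] -[x [N [e ->]]] a b l; rewrite !inE /= => ha hb.
  have l0 : 0 <= l%:num by exact: ge0.
  have l1 : 0 <= 1 - l%:num by rewrite subr_ge0 le1.
  have ln : Normc.normc l%:num + Normc.normc (1 - l%:num) = 1.
    apply: (@complexI R); rewrite rmorphD /=.
    rewrite -[X in X + _]/((Normc.normc l%:num)%:C)%C.
    rewrite -[X in _ + X]/((Normc.normc (1 - l%:num))%:C)%C.
    have nE (k : R[i]) : 0 <= k -> ((Normc.normc k)%:C)%C = k.
      by move=> /ger0_norm {2}<-; rewrite normc_def; case: (k).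
    by rewrite !nE// addrC subrK.
  have -> : (a <| l |> b : car) - x = l%:num *: (a - x) + (1 - l%:num) *: (b - x).
    rewrite -[_ <| _ |> _]/(l%:num *: (a : car) + (1 - l%:num) *: (b : car)).
    by rewrite !scalerBr addrACA -opprD -scalerDl addrCA subrr addr0 scale1r.
  apply: le_lt_trans (ssa_normD _ _ _) _; rewrite !ssa_normZ.
  have mlt : Num.max (ssa_norm N (a - x)) (ssa_norm N (b - x)) < e.
    by rewrite gt_max ha hb.
  apply: le_lt_trans mlt; rewrite -[leRHS]mul1r -ln mulrDl.
  by rewrite lerD// ler_wpM2l ?normc_ge0// le_max lexx ?orbT.
split.
  move=> _ [x [N [e ->]]]; rewrite openE => y /= xy.
  apply/ssa_nbhsP; exists N, (e - ssa_norm N (y - x)).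
  rewrite subr_gt0; split=> // z; rewrite ltrBrDr; apply: le_lt_trans.
  exact: ssa_normT.
move=> x U /ssa_nbhsP [N [e [e0 He]]].
exists [set y | ssa_norm N (y - x) < e] => //; split; first by exists x, N, e.
by rewrite /= subrr ssa_norm0.
Qed.
HB.instance Definition _ :=
  Uniform_isTvs.Build R[i] car ssa_locally_convex.

Local Close Scope convex_scope.

Lemma ssa_one_mem : 1 \in ssa_pred.
Proof. by apply/ssa_predP; have [] := ssa_subalgebra D. Qed.

Lemma ssa_mul_mem (x y : car) : ssa_val x * ssa_val y \in ssa_pred.
Proof.
apply/ssa_predP; have [_ _ h] := ssa_subalgebra D.
by apply: h; exact: ssa_valP.
Qed.

Definition ssa_one : car := SsaCar ssa_one_mem.
Definition ssa_mul (x y : car) : car := SsaCar (ssa_mul_mem x y).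

Lemma ssa_norm_mul N x y :
  ssa_norm N (ssa_mul x y) <= ssa_norm N x * ssa_norm N y.
Proof. by apply: ssa_leM; exact: ssa_valP. Qed.

Lemma ssa_mulA : associative ssa_mul.
Proof. by move=> x y z; apply: val_inj; exact: mulrA. Qed.
Lemma ssa_mul1r : left_id ssa_one ssa_mul.
Proof. by move=> x; apply: val_inj; exact: mul1r. Qed.
Lemma ssa_mulr1 : right_id ssa_one ssa_mul.
Proof. by move=> x; apply: val_inj; exact: mulr1. Qed.
Lemma ssa_mulDl : left_distributive ssa_mul +%R.
Proof. by move=> x y z; apply: val_inj; exact: mulrDl. Qed.
Lemma ssa_mulDr : right_distributive ssa_mul +%R.
Proof. by move=> x y z; apply: val_inj; exact: mulrDr. Qed.
Lemma ssa_scaleAl (k : R[i]) x y : k *: ssa_mul x y = ssa_mul (k *: x) y.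
Proof. by apply: val_inj; exact: topalg_scaleAl. Qed.
Lemma ssa_scaleAr (k : R[i]) x y : k *: ssa_mul x y = ssa_mul x (k *: y).
Proof. by apply: val_inj; exact: topalg_scaleAr. Qed.

Lemma ssa_mul_continuous : continuous (fun z : car * car => ssa_mul z.1 z.2).
Proof.
move=> [x y] U /ssa_nbhsP [N [e [e0 He]]].
pose m := ssa_norm N x + 1 + ssa_norm N y.
have m0 : 0 < m by rewrite /m -addrA addrCA ltr_pwDl// addr_ge0// ssa_norm_ge0.
pose d := Num.min 1 (e / (m + m)).
have mm0 : 0 < m + m by rewrite addr_gt0.
have d0 : 0 < d by rewrite lt_min ltr01 divr_gt0.
exists ([set z | ssa_norm N (z - x) < d], [set z | ssa_norm N (z - y) < d]).
  by split; exact: ssa_nbhs_ball.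
move=> [a b] /= [h1 h2]; apply: He.
have -> : ssa_mul a b - ssa_mul x y = ssa_mul a (b - y) + ssa_mul (a - x) y.
  apply: val_inj => /=; rewrite -[LHS]/(ssa_val a * ssa_val b - ssa_val x * ssa_val y).
  rewrite -[RHS]/(ssa_val a * (ssa_val b - ssa_val y) + (ssa_val a - ssa_val x) * ssa_val y).
  by rewrite mulrBr mulrBl addrA subrK.
apply: le_lt_trans (ssa_normD _ _ _) _.
have hl : ssa_norm N a <= ssa_norm N x + 1.
  have -> : a = x + (a - x) by rewrite addrC subrK.
  apply: le_trans (ssa_normD _ _ _) _; rewrite lerD2l.
  by apply/ltW/(lt_le_trans h1); rewrite /d ge_min lexx.
have hm1 : ssa_norm N x + 1 <= m by rewrite /m lerDl ssa_norm_ge0.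
have hm2 : ssa_norm N y <= m by rewrite /m lerDr addr_ge0// ssa_norm_ge0.
have dm : d * (m + m) <= e.
  by rewrite -ler_pdivlMr// /d ge_min lexx orbT.
apply: lt_le_trans dm; rewrite mulrDr ltr_leD//.
  apply: (@le_lt_trans _ _ (m * ssa_norm N (b - y))).
    apply: le_trans (ssa_norm_mul _ _ _) _.
    by rewrite ler_wpM2r ?ssa_norm_ge0// (le_trans hl).
  by rewrite mulrC ltr_pM2r.
apply: le_trans (ssa_norm_mul _ _ _) _.
by apply: ler_pM => //; [exact: ssa_norm_ge0|exact: ssa_norm_ge0|exact: ltW].
Qed.

HB.instance Definition _ := isTopologicalAlgebra.Build R[i] car
  ssa_mulA ssa_mul1r ssa_mulr1 ssa_mulDl ssa_mulDr ssa_scaleAl ssa_scaleAr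
  ssa_mul_continuous ssa_add_unif.

Lemma ssa_topology :
  @topology_defined_by R car (range ssa_norm).
Proof.
apply: topology_defined_byI; first by move=> _ x e [N _ <-]; exact: ssa_nbhs_ball.
by move=> x U /ssa_nbhsP [N [e [e0 He]]]; exists (ssa_norm N), e; split=> //; exists N.
Qed.

Lemma ssa_norm_seminorm N : @seminorm R car (ssa_norm N).
Proof.
by split; [exact: ssa_norm_ge0|exact: ssa_normD|exact: ssa_normZ].
Qed.

Lemma ssa_locally_m_convex : @locally_m_convex R car.
Proof.
exists (range ssa_norm); last exact: ssa_topology.
by move=> _ [N _ <-]; split; [exact: ssa_norm_seminorm|exact: ssa_norm_mul].
Qed.

Lemma ssa_hausdorff :
  (forall x, (forall N, ssa_norm N x = 0) -> x = 0) -> hausdorff_space car.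
Proof.
move=> sep x y xy; apply/eqP; rewrite -subr_eq0; apply/eqP/sep => N.
apply/eqP; rewrite eq_le ssa_norm_ge0 andbT; apply/ler_addgt0Pr => e e0.
have e20 : 0 < e / 2 by rewrite divr_gt0.
have [z [/= zx zy]] := xy _ _ (ssa_nbhs_ball x N e20) (ssa_nbhs_ball y N e20).
rewrite add0r (le_trans (ssa_normT N z _ _))// (splitr e) ssa_normB.
by rewrite ltW// ltrD.
Qed.

(** A Cauchy filter contains, for each j, a set that is small for the seminorm of
index j; points chosen in the successive intersections of these sets form a
rapidly converging sequence, and its limit is a limit of the filter. *)
Lemma ssa_complete : @fast_complete R car ssa_norm -> complete_space car.
Proof.
move=> fc F FF cF.
have /choice [B FBB] : forall j, exists B, F B /\
    forall x y, B x -> B y -> ssa_norm j (y - x) < 2^-1 ^+ j.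
  move=> j; have [|[B C] /= [FB FC] BC] :=
      cF [set z : car * car | ssa_norm j (z.2 - z.1) < 2^-1 ^+ j].
    by exists j, (2^-1 ^+ j); rewrite exprn_gt0.
  exists (B `&` C); split; first exact: filterI.
  by move=> x y [Bx _] [_ Cy]; exact: (BC (x, y)).
have FB j : F (B j) by have [] := FBB j.
have HB j := (FBB j).2.
pose G j := \bigcap_(i in [set i | (i <= j)%N]) B i.
have FG j : F (G j).
  elim: j => [|j IH].
    by apply: filterS (FB 0%N) => x Bx i /=; rewrite leqn0 => /eqP ->.
  apply: filterS (filterI IH (FB j.+1)) => x [Gx Bx] i /=.
  rewrite leq_eqVlt ltnS => /orP[/eqP ->|ij]; first exact: Bx.
  exact: (Gx i ij).
have /choice [x Gx] : forall j, exists x, G j x by move=> j; exact: (@filter_ex _ F FF _ (FG j)).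
have Bx i j : (i <= j)%N -> B i (x j) by move=> ij; exact: (Gx j i ij).
have [l xl] := fc x (fun j => ltW (HB j _ _ (Bx _ _ (leqnn j)) (Bx _ _ (leqnSn j)))).
exists l => U /ssa_nbhsP [N [e [e0 He]]].
have e20 : 0 < e / 2 by rewrite divr_gt0.
have [M1 H1] := pow2_small e20; have [M2 H2] := xl N _ e20.
pose m := maxn N (maxn M1 M2).
apply: filterS (FB m) => y By; apply: He.
rewrite (le_lt_trans (ssa_normT N (x m) _ _))// (splitr e) ltrD//; last first.
  by apply: H2; rewrite /m !leq_max leqnn !orbT.
apply: le_lt_trans (ssa_norm_le _ (leq_maxl N (maxn M1 M2))) _.
apply: lt_le_trans (HB m _ _ (Bx _ _ (leqnn m)) By) _.
have := H1 m; rewrite /m !leq_max leqnn orbT => /(_ isT) /ltW; apply: le_trans.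
by rewrite ler_peMl ?exprn_ge0// ler1n.
Qed.

End Carrier.

(** * Continuous homomorphisms of Arens-Michael algebras *)

Section ArensMichaelGauge.
Variables (R : realType) (A : topAlgType R[i]).
Hypothesis amA : arens_michael A.

Lemma arens_michael_gauge : exists Q : set (A -> R),
  [/\ Q `<=` @seminorm R A, Q `<=` @submultiplicative R A &
      topology_defined_by Q].
Proof.
have [[Q hQ topQ] _ _] := amA.
by exists Q; split=> // p /hQ [].
Qed.

Lemma free_eval_evaluates n (a : 'I_n -> A) c : free_entire c ->
  evaluates a c (free_eval c a).
Proof.
have [_ hA cA] := amA; have [Q [semQ mulQ topQ]] := arens_michael_gauge.
exact: (evaluates_free_eval semQ mulQ topQ hA cA).
Qed.

Lemma evaluates_free_evalE n (a : 'I_n -> A) c x :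
  evaluates a c x -> free_eval c a = x.
Proof. by have [_ hA _] := amA; exact: (evaluates_eq hA). Qed.

End ArensMichaelGauge.

Section ContinuousHom.
Variables (R : realType) (A B : topAlgType R[i]) (phi : A -> B).
Hypothesis hphi : continuous_hom phi.

Lemma hom_linear k x y : phi (k *: x + y) = k *: phi x + phi y.
Proof. by case: hphi => h _ _; exact: h. Qed.

Lemma hom0 : phi 0 = 0.
Proof.
have := hom_linear (-1) 0 0.
by rewrite !scaleN1r oppr0 addr0 addNr.
Qed.

Lemma homB x y : phi (x - y) = phi x - phi y.
Proof. by rewrite addrC -scaleN1r hom_linear scaleN1r addrC. Qed.

Lemma homM x y : phi (x * y) = phi x * phi y.
Proof. by case: hphi => _ [_ h] _; exact: h. Qed.

Lemma hom1 : phi 1 = 1.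
Proof. by case: hphi => _ [h _] _; exact: h. Qed.

Lemma hom_monomial n (a : 'I_n -> A) w :
  phi (monomial a w) = monomial (phi \o a) w.
Proof.
rewrite /monomial; elim: w => [|i w IH]; first by rewrite !big_nil hom1.
by rewrite !big_cons homM IH.
Qed.

Lemma hom_partial_sum n (a : 'I_n -> A) c J :
  phi (partial_sum a c J) = partial_sum (phi \o a) c J.
Proof.
rewrite /partial_sum; elim: (enum_fset J) => [|w s IH].
  by rewrite !big_nil hom0.
by rewrite !big_cons hom_linear IH hom_monomial.
Qed.

Lemma hom_evaluates n (a : 'I_n -> A) c x :
  evaluates a c x -> evaluates (phi \o a) c (phi x).
Proof.
move=> hx; rewrite /evaluates.
rewrite (_ : partial_sum (phi \o a) c = phi \o partial_sum a c).
  by apply: (cvg_comp _ _ hx); case: hphi => _ _ cphi; exact: cphi.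
by apply/funext => J /=; rewrite hom_partial_sum.
Qed.

Hypotheses (amA : arens_michael A) (amB : arens_michael B).

Lemma hom_free_eval n (a : 'I_n -> A) c : free_entire c ->
  phi (free_eval c a) = free_eval c (phi \o a).
Proof.
move=> hc; symmetry; apply: evaluates_free_evalE => //.
exact/hom_evaluates/free_eval_evaluates.
Qed.

Lemma holomorphically_closed_preimage (H : set B) :
  holomorphically_closed H -> holomorphically_closed (phi @^-1` H).
Proof.
move=> [[H1 Hl HM] Hf]; split; first split.
- by rewrite /preimage /= hom1.
- by move=> k x y hx hy; rewrite /preimage /= hom_linear; exact: Hl.
- by move=> x y hx hy; rewrite /preimage /= homM; exact: HM.
- move=> n b f hb hf; rewrite /preimage /= hom_free_eval//; exact: Hf.
Qed.

(** The sum f(b) is computed in the source, on preimages of the b i. *)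
Lemma holomorphically_closed_range : holomorphically_closed (range phi).
Proof.
split; first split.
- by exists 1 => //; exact: hom1.
- move=> k _ _ [x _ <-] [y _ <-]; exists (k *: x + y) => //; exact: hom_linear.
- move=> _ _ [x _ <-] [y _ <-]; exists (x * y) => //; exact: homM.
- move=> n b f hb hf.
  have /choice [a ha] : forall i, exists x, phi x = b i.
    by move=> i; have [x _ <-] := hb i; exists x.
  exists (free_eval f a) => //; rewrite hom_free_eval//; congr (free_eval _ _).
  exact/funext.
Qed.

End ContinuousHom.

(** * The algebra of values of free entire series *)

Section EntireSubalgebra.
Variables (R : realType) (A : topAlgType R[i]) (amA : arens_michael A).
Variables (n : nat) (a : 'I_n -> A).
Implicit Types (c d : seq 'I_n -> R[i]) (x y : A).

Definition represents c x := free_entire c /\ evaluates a c x.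

Definition entire_values : set A := [set x | exists c, represents c x].

(** The quotient seminorm of the norm of radius N.+1 (the shift keeps radii
positive). When x is not a value of an entire series the set is empty, and its
infimum is 0. *)
Definition quotient_norm (N : nat) x : R :=
  inf [set M | exists2 c, represents c x & norm_le N.+1%:R c M].

Lemma quotient_norm_lb N x : lbound
  [set M | exists2 c, represents c x & norm_le N.+1%:R c M] 0.
Proof. by move=> M [c _ /norm_le_ge0]. Qed.

Lemma quotient_norm_ge0 N x : 0 <= quotient_norm N x.
Proof.
rewrite /quotient_norm; have [h|/nonemptyPn ->] := pselect
    ([set M | exists2 c, represents c x & norm_le N.+1%:R c M] !=set0).
  exact: lb_le_inf h (@quotient_norm_lb N x).
by rewrite inf0.
Qed.

Lemma quotient_norm_le N c x M : represents c x -> norm_le N.+1%:R c M ->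
  quotient_norm N x <= M.
Proof.
move=> cx cM; apply: ge_inf; last by exists c.
by exists 0; exact: quotient_norm_lb.
Qed.

Lemma quotient_norm_adherent N x e : entire_values x -> quotient_norm N x < e ->
  exists2 c, represents c x & norm_le N.+1%:R c e.
Proof.
move=> [c0 cx0] hx.
have [|M [c cx cM] Me] := @inf_lt _
  [set M | exists2 c, represents c x & norm_le N.+1%:R c M] e _ hx.
  by have [M HM] := (free_entireP c0).1 cx0.1 N.+1%:R (ltr0Sn _ _); exists M, c0.
by exists c => //; apply: norm_le_trans cM (ltW Me).
Qed.

Lemma represents0 : represents (fun=> 0) 0.
Proof.
split; last exact: evaluates0.
exact: free_entire0.
Qed.

Lemma represents_linear k c d x y : represents c x -> represents d y ->
  represents (fun w => k * c w + d w) (k *: x + y).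
Proof.
move=> [ec hx] [ed hy]; split; first exact: free_entire_linear.
exact: evaluates_linear.
Qed.

Lemma represents_conv c d x y : represents c x -> represents d y ->
  represents (conv c d) (x * y).
Proof.
move=> [ec hx] [ed hy]; split; first exact: free_entire_conv.
have [_ hA cA] := amA; have [Q [semQ mulQ topQ]] := arens_michael_gauge amA.
exact: (evaluates_conv semQ mulQ topQ hA cA).
Qed.

Lemma represents_monomial w : represents (fun v => (w == v)%:R) (monomial a w).
Proof. by split; [exact: free_entire_delta|exact: evaluates_delta]. Qed.

Lemma entire_values_subalgebra : subalgebra entire_values.
Proof.
split.
- exists (fun w => ([::] == w)%:R).
  by have := represents_monomial [::]; rewrite /monomial big_nil.
- move=> k x y [c cx] [d dy]; exists (fun w => k * c w + d w).
  exact: represents_linear.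
- by move=> x y [c cx] [d dy]; exists (conv c d); exact: represents_conv.
Qed.

Lemma entire_values_generator i : entire_values (a i).
Proof.
by exists (fun w => ([:: i] == w)%:R); have := represents_monomial [:: i];
   rewrite /monomial big_seq1.
Qed.

Lemma quotient_norm_near N x e : entire_values x -> 0 < e ->
  exists2 c, represents c x & norm_le N.+1%:R c (quotient_norm N x + e).
Proof. by move=> hx e0; apply: quotient_norm_adherent => //; rewrite ltrDl. Qed.

Lemma quotient_normD N x y : entire_values x -> entire_values y ->
  quotient_norm N (x + y) <= quotient_norm N x + quotient_norm N y.
Proof.
move=> hx hy; apply/ler_addgt0Pr => e e0.
have e20 : 0 < e / 2 by rewrite divr_gt0.
have [c cx cM] := quotient_norm_near N hx e20.
have [d dy dM] := quotient_norm_near N hy e20.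
rewrite (splitr e) addrACA; apply: quotient_norm_le (norm_leD _ cM dM) => //.
have := represents_linear 1 cx dy; rewrite scale1r.
by congr (represents _ _); apply/funext => w; rewrite mul1r.
Qed.

Lemma quotient_normZ N k x : entire_values x ->
  quotient_norm N (k *: x) <= Normc.normc k * quotient_norm N x.
Proof.
move=> hx; apply/ler_addgt0Pr => e e0.
have k1 : 0 < Normc.normc k + 1 by rewrite ltr_wpDl// normc_ge0.
have [c cx cM] := quotient_norm_near N hx (divr_gt0 e0 k1).
apply: (@le_trans _ _ (Normc.normc k * (quotient_norm N x + e / (Normc.normc k + 1)))).
  apply: quotient_norm_le (norm_leZ k cM).
  have := represents_linear k cx represents0; rewrite addr0.
  by congr (represents _ _); apply/funext => w; rewrite addr0.
rewrite mulrDr lerD2l mulrCA -[leRHS]mulr1 ler_pM2l//.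
by rewrite ler_pdivrMr// mul1r lerDl.
Qed.

Lemma quotient_normM N x y : entire_values x -> entire_values y ->
  quotient_norm N (x * y) <= quotient_norm N x * quotient_norm N y.
Proof.
move=> hx hy; apply/ler_addgt0Pr => e e0.
pose C := quotient_norm N x + quotient_norm N y + 1.
have C1 : 1 <= C by rewrite lerDr addr_ge0// quotient_norm_ge0.
have C0 : 0 < C by apply: lt_le_trans C1.
pose d := Num.min 1 (e / C).
have d0 : 0 < d by rewrite lt_min ltr01 divr_gt0.
have d1 : d <= 1 by rewrite ge_min lexx.
have dC : d * C <= e by rewrite -ler_pdivlMr// ge_min lexx orbT.
have [c cx cM] := quotient_norm_near N hx d0.
have [c' cy cN] := quotient_norm_near N hy d0.
have := quotient_norm_le (represents_conv cx cy) (norm_le_conv (ler0n _ _) cM cN).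
move/le_trans; apply; rewrite mulrDl mulrDr -addrA lerD2l.
apply: le_trans dC; rewrite /C; set u := quotient_norm N x; set v := quotient_norm N y.
have : d * d <= d by rewrite ler_piMl// ltW.
by rewrite mulrDr [u * d]mulrC !mulrDr mulr1; lra.
Qed.

Lemma quotient_normS N x : entire_values x ->
  quotient_norm N x <= quotient_norm N.+1 x.
Proof.
move=> hx; apply/ler_addgt0Pr => e e0.
have [c cx cM] := quotient_norm_near N.+1 hx e0.
apply: quotient_norm_le cx _; apply: norm_le_radius cM => //.
by rewrite ler_nat.
Qed.

Definition entire_algebra_data : seminormed_subalgebra A :=
  Build_seminormed_subalgebra entire_values_subalgebra quotient_norm_ge0
    quotient_normD quotient_normZ quotient_normM quotient_normS.

Definition entire_algebra : topAlgType R[i] := ssa_car entire_algebra_data.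

Definition entire_val (x : entire_algebra) : A := ssa_val x.

(** The inclusion of the values in A is continuous: a gauge p is controlled by
the seminorm of any radius that bounds p on the generators. *)
Lemma quotient_norm_dominates (Q : set (A -> R)) p :
  Q `<=` @seminorm R A -> Q `<=` @submultiplicative R A ->
  topology_defined_by Q -> Q p ->
  exists N, forall x, entire_values x -> p x <= p 1 * quotient_norm N x.
Proof.
move=> semQ mulQ topQ Qp; have semp := semQ _ Qp.
have [rho r0 ha] := gauge_radius a semQ Qp.
exists (Num.truncn rho) => x hx.
have haN i : p (a i) <= (Num.truncn rho).+1%:R.
  by apply: le_trans (ha i) _; rewrite ltW// truncnS_gt.
have p10 := seminorm_ge0 semp 1.
apply/ler_addgt0Pr => e e0.
have p1 : 0 < p 1 + 1 by rewrite ltr_wpDl.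
have [c [_ cx] cM] := quotient_norm_near (Num.truncn rho) hx (divr_gt0 e0 p1).
apply: le_trans (evaluates_le semQ mulQ topQ Qp haN cM cx) _.
rewrite mulrDr lerD2l mulrCA -[leRHS]mulr1 ler_pM2l//.
by rewrite ler_pdivrMr// mul1r lerDl.
Qed.

Lemma entire_valP (x : entire_algebra) : entire_values (entire_val x).
Proof. exact: (@ssa_valP R A entire_algebra_data x). Qed.

Lemma entire_val_hom : continuous_hom entire_val.
Proof.
have [Q [semQ mulQ topQ]] := arens_michael_gauge amA.
split.
- by move=> k x y; exact: ssa_val_linear.
- by split.
move=> x; have FF : Filter (entire_val @ nbhs x) by exact: fmap_filter.
apply: (gauge_cvg topQ FF) => p e Qp e0.
have [N HN] := quotient_norm_dominates semQ mulQ topQ Qp.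
have p10 : 0 < p 1 + 1 by rewrite ltr_wpDl// seminorm_ge0//; exact: semQ.
have := @ssa_nbhs_ball R A entire_algebra_data x N _ (divr_gt0 e0 p10).
apply: filterS => y /=; rewrite ltr_pdivlMr// => h.
have := HN _ (entire_valP (y - x)).
move=> /le_lt_trans; apply; apply: le_lt_trans h; rewrite mulrC.
by rewrite ler_wpM2l ?lerDl// quotient_norm_ge0.
Qed.

Lemma entire_val_inj : injective entire_val.
Proof. exact: val_inj. Qed.

(** A quotient of a complete metrizable space is complete: the increments lift to
series of nearly the same norm, whose sum c exists by [fast_series]. Linearity of
evaluation alone turns the bound on the tails of c into the convergence of the
sequence. *)
Lemma entire_algebra_complete : @fast_complete R entire_algebra
  (@ssa_norm R A entire_algebra_data).
Proof.
move=> x hx.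
(* the increment of index j.+1 is used at rank j, which makes the bound on its *)
(* quotient seminorm strict *)
have /choice [f hf] : forall j, exists f,
    represents f (entire_val (x j.+2 - x j.+1)) /\
    norm_le j.+1%:R f (2^-1 ^+ j).
  move=> j.
  have [|f fx fM] := @quotient_norm_adherent j
      (entire_val (x j.+2 - x j.+1)) (2^-1 ^+ j) (entire_valP _).
    apply: le_lt_trans (quotient_normS j (entire_valP _)) _.
    apply: le_lt_trans (hx j.+1) _.
    by rewrite exprS gtr_pMl ?exprn_gt0// invf_lt1// ltr1n.
  by exists f.
have [c ec hc] := fast_series (fun j => (hf j).1.1) (fun j => (hf j).2).
have hev := free_eval_evaluates amA (a := a) ec.
set z := free_eval c a in hev.
have hz : entire_values z by exists c.
have zin : z \in ssa_pred entire_algebra_data by apply/ssa_predP.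
pose z' : entire_algebra := SsaCar zin.
have tele m : x m.+1 = x 1%N + \sum_(j < m) (x j.+2 - x j.+1).
  elim: m => [|m IH]; first by rewrite big_ord0 addr0.
  by rewrite big_ord_recr /= addrA -IH addrC subrK.
exists (x 1%N + z') => N e e0.
have [M HM] := pow2_small e0.
exists (maxn N M).+1 => -[//|m]; rewrite ltnS geq_max => /andP[Nm Mm].
have -> : x m.+1 - (x 1%N + z') = - (z' - \sum_(j < m) (x j.+2 - x j.+1)).
  by rewrite tele opprD addrACA subrr add0r opprB.
rewrite ssa_normN; apply: le_lt_trans (HM m Mm).
apply: quotient_norm_le (hc N m Nm).
have sumrep : evaluates a (fun w => \sum_(j < m) f j w)
    (\sum_(j < m) entire_val (x j.+2 - x j.+1)).
  have := @evaluates_sum R A n a _ (index_enum 'I_m) (fun=> 1) (fun j => f j)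
    (fun j => entire_val (x j.+2 - x j.+1)) (fun j => (hf j).1.2).
  congr (evaluates _ _ _); last by apply: eq_bigr => j _; rewrite scale1r.
  by apply/funext => w; apply: eq_bigr => j _; rewrite mul1r.
have sumval : \sum_(j < m) entire_val (x j.+2 - x j.+1) =
    entire_val (\sum_(j < m) (x j.+2 - x j.+1)).
  elim: m {Nm Mm sumrep} => [|m IH]; first by rewrite !big_ord0.
  by rewrite !big_ord_recr /= IH.
split; first exact: (free_entireB ec (free_entire_sum m (fun j => (hf j).1.1))).
by rewrite -[ssa_val _]/(z - entire_val _) -sumval; exact: evaluatesB.
Qed.

Lemma entire_algebra_am : arens_michael entire_algebra.
Proof.
have [_ hA _] := amA; have [Q [semQ mulQ topQ]] := arens_michael_gauge amA.
split; first exact: ssa_locally_m_convex.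
- apply: ssa_hausdorff => x x0; apply: entire_val_inj.
  apply: (gauge_separated semQ topQ hA) => p Qp; have semp := semQ _ Qp.
  have [N HN] := quotient_norm_dominates semQ mulQ topQ Qp.
  apply/eqP; rewrite eq_le seminorm_ge0// andbT.
  apply: le_trans (HN _ (entire_valP x)) _.
  by rewrite -[quotient_norm _ _]/(ssa_norm N x) x0 mulr0.
- apply: ssa_complete; exact: entire_algebra_complete.
Qed.

(** A free entire series of values is summed inside the Arens-Michael algebra of
values, and the continuous inclusion carries its sum to A. *)
Lemma entire_values_closed : holomorphically_closed entire_values.
Proof.
have := holomorphically_closed_range entire_val_hom entire_algebra_am amA.
congr holomorphically_closed; apply/seteqP; split.
  by move=> _ [x _ <-]; exact: entire_valP.
move=> x hx; have xin : x \in ssa_pred entire_algebra_data by apply/ssa_predP.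
by exists (SsaCar xin).
Qed.

Lemma entire_values_Hol : entire_values `<=` Hol (range a).
Proof.
move=> x [c [ec cx]] H [[_ Hf] aH].
rewrite -(evaluates_free_evalE amA cx); apply: Hf => // i.
by apply: aH; exists i.
Qed.

End EntireSubalgebra.
Arguments entire_val {R A amA n a} x.

(** * Analytic free products *)

(** Partial sums of an enumeration of the countable family. *)
Lemma frechet_increasing (R : realType) (A : topAlgType R[i]) :
  frechet_space A -> exists p : nat -> A -> R,
    increasing_seminorms p /\ topology_defined_by (range p).
Proof.
move=> [[Q [cQ semQ topQ]] _ _].
have [g [semg gQ Qg]] : exists g : nat -> A -> R, [/\ forall i, seminorm (g i),
    forall i, Q (g i) \/ (forall x, g i x = 0) & forall q, Q q -> exists i, g i = q].
  move: cQ => /pfcard_geP[Q0|/unsquash f].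
    exists (fun _ _ => 0); split; last by rewrite Q0.
      by move=> _; split=> *; rewrite ?addr0 ?mulr0.
    by right.
  exists f; split=> [i|i|q /(@surj _ _ _ _ f)[i _ <-]]; last by exists i.
    by apply: semQ; exact: funS.
  by left; exact: funS.
pose p k x := \sum_(i < k.+1) g i x.
have pS k x : p k.+1 x = p k x + g k.+1 x by rewrite /p big_ord_recr.
have gp i k x : (i <= k)%N -> g i x <= p k x.
  move=> ik; have ik' : (i < k.+1)%N by [].
  rewrite /p (bigD1 (Ordinal ik'))//= lerDl sumr_ge0// => j _.
  exact: seminorm_ge0.
have incp : increasing_seminorms p.
  split; last by move=> k x; rewrite pS lerDl seminorm_ge0.
  move=> k; split.
  - by move=> x; apply: sumr_ge0 => i _; exact: seminorm_ge0.
  - by move=> x y; rewrite -big_split; apply: ler_sum => i _; exact: seminormD.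
  - by move=> c x; rewrite mulr_sumr; apply: eq_bigr => i _; exact: seminormZ.
exists p; split=> //.
have gball i x e : 0 < e -> nbhs x [set y | g i (y - x) < e].
  move=> e0; have [Qgi|g0] := gQ i; first exact: (gauge_nbhs topQ).
  by apply: filterS filterT => y _ /=; rewrite g0.
apply: topology_defined_byI.
  move=> _ x e [k _ <-]; elim: k e => [|k IH] e e0.
    by apply: filterS (gball 0%N x e e0) => y; rewrite /p /= big_ord1.
  have e20 : 0 < e / 2 by rewrite divr_gt0.
  apply: (@filterS _ (nbhs x) _ _ _ _ (filterI (IH _ e20) (gball k.+1 x _ e20))).
  move=> y [/= h1 h2].
  by rewrite pS (splitr e) ltrD.
move=> x U /topQ [J [e [/finite_seqP [S JS] JQ e0 He]]].
suff [k Hk] : exists k, forall q, q \in S -> forall y, q y <= p k y.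
  exists (p k), e; split=> //.
  move=> y hy; apply: He => q; rewrite JS => /Hk qp.
  exact: le_lt_trans (qp _) hy.
have hS : forall q, q \in S -> Q q by move=> q qS; apply: JQ; rewrite JS.
elim: S hS {JS} => [|q S IH] hS; first by exists 0%N.
have [k Hk] := IH (fun r rS => hS r (mem_behead (s := q :: S) rS)).
have [i gi] := Qg q (hS q (mem_head _ _)).
exists (maxn k i) => r; rewrite inE => /orP[/eqP ->|/Hk rp] y.
  by rewrite -gi gp// leq_maxr.
by apply: le_trans (rp y) _; apply: (seminorms_le incp); exact: leq_maxl.
Qed.

Section Lift.
Variables (R : realType) (A P : topAlgType R[i]) (amP : arens_michael P).
Variables (n : nat) (a : 'I_n -> P).
Hypothesis frA : frechet_arens_michael A.
Variables (j : A -> P).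
Hypotheses (hj : continuous_hom j) (jX : forall x, entire_values a (j x)).

Local Notation X := (entire_algebra amP a).
Local Notation norm := (@ssa_norm R P (entire_algebra_data amP a)).

(** Closed graph theorem. The seminorms q N add to those of A the pullbacks of
those of the values; they are complete because a limit in A and a limit of the
images have the same image in the Hausdorff algebra P. As q is finer than p, both
define the same topology, and the corestriction of j is continuous. *)
Lemma entire_lift : exists j' : A -> X,
  continuous_hom j' /\ forall x, entire_val (j' x) = j x.
Proof.
have [amA frechetA] := frA; have [_ hA cA] := frechetA.
have [p [incp topp]] := frechet_increasing frechetA.
have jin x : j x \in ssa_pred (entire_algebra_data amP a) by apply/ssa_predP; exact: jX.
pose j' x : X := SsaCar (jin x).
have j'l k x y : j' (k *: x + y) = k *: j' x + j' y.
  by apply: entire_val_inj; exact: hom_linear.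
have j'D x y : j' (x + y) = j' x + j' y.
  by have := j'l 1 x y; rewrite !scale1r.
have j'0 : j' 0 = 0 by apply: entire_val_inj; exact: hom0.
have j'Z k x : j' (k *: x) = k *: j' x.
  by have := j'l k x 0; rewrite j'0 !addr0.
have j'B x y : j' (x - y) = j' x - j' y.
  by rewrite -scaleN1r j'D j'Z scaleN1r.
exists j'; split=> //; split => //.
  by split=> [|x y]; apply: entire_val_inj; [exact: hom1|exact: homM].
have [semp leSp] := incp.
have semn N : @seminorm R X (norm N) by exact: ssa_norm_seminorm.
pose q N x := p N x + norm N (j' x).
have incq : increasing_seminorms q.
  split.
    move=> N; split.
    - by move=> x; rewrite addr_ge0// ?ssa_norm_ge0// seminorm_ge0.
    - move=> x y; rewrite /q addrACA j'D lerD ?ssa_normD//; exact: seminormD.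
    - by move=> k x; rewrite /q mulrDr j'Z ssa_normZ seminormZ.
  by move=> N x; rewrite lerD// ssa_norm_le.
have [_ hausP _] := amP.
have q_complete : fast_complete q.
  move=> x hx.
  have [|l hl] := complete_fast_complete incp topp cA (x := x).
    by move=> i; apply: le_trans (hx i); rewrite /q lerDl ssa_norm_ge0.
  have [|y hy] := @entire_algebra_complete R P amP n a (fun i => j' (x i)).
    move=> i; rewrite -j'B; apply: le_trans (hx i).
    by rewrite /q lerDr seminorm_ge0.
  have yl : y = j' l.
    apply: entire_val_inj.
    have c1 : (entire_val \o (fun i => j' (x i))) @ \oo --> entire_val y.
      have [_ _ cv] := entire_val_hom amP a.
      have hy' : (fun i => j' (x i)) @ \oo --> y.
        exact: tends_to_cvg (@ssa_topology R P (entire_algebra_data amP a)) hy.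
      exact: (cvg_comp _ _ hy' (cv y)).
    have c2 : (j \o x) @ \oo --> j l.
      have [_ _ cj] := hj.
      exact: (cvg_comp _ _ (tends_to_cvg topp hl) (cj l)).
    exact: (cvg_unique hausP c1 c2).
  exists l => k e e0; have e20 : 0 < e / 2 by rewrite divr_gt0.
  have [M1 H1] := hl k _ e20; have [M2 H2] := hy k _ e20.
  exists (maxn M1 M2) => m; rewrite geq_max => /andP[/H1 h1 /H2 h2].
  by rewrite /q (splitr e) ltrD// j'B -yl.
have psep x : (forall k, p k x = 0) -> x = 0.
  move=> px; apply: (gauge_separated _ topp hA); first by move=> _ [k _ <-].
  by move=> _ [k _ <-].
move=> x U /ssa_nbhsP [N [e [e0 He]]].
have [||k [d [d0 hd]]] := finer_seminorms_continuous incp incq _ psep _ q_complete N e0.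
- by move=> k y; rewrite /q lerDl ssa_norm_ge0.
- exact: complete_fast_complete.
have := gauge_nbhs topp x (p := p k) _ d0; move=> /(_ (ex_intro2 _ _ k I erefl)).
apply: filterS => y /= /hd qy; apply: He; rewrite -j'B.
by apply: le_lt_trans qy; rewrite /q lerDr seminorm_ge0.
Qed.

End Lift.

Lemma continuous_hom_id (R : realType) (A : topAlgType R[i]) :
  continuous_hom (@id A).
Proof. by split=> [k x y//||x]; [split|exact: cvg_id]. Qed.

Lemma continuous_hom_comp (R : realType) (A B C : topAlgType R[i])
    (f : A -> B) (g : B -> C) :
  continuous_hom f -> continuous_hom g -> continuous_hom (g \o f).
Proof.
move=> hf hg; split.
- by move=> k x y; rewrite /= !hom_linear.
- by split=> [|x y]; rewrite /= ?homM ?hom1.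
- move=> x; have [_ _ cf] := hf; have [_ _ cg] := hg.
  exact: continuous_comp (cf x) (cg _).
Qed.

(** The preimage of the values is holomorphically closed and contains S. *)
Lemma hom_into_entire_values (R : realType) (A P : topAlgType R[i]) (j : A -> P)
    (S : set A) n (a : 'I_n -> P) :
  arens_michael A -> arens_michael P -> continuous_hom j -> Hol S = [set: A] ->
  j @` S `<=` range a -> forall x, entire_values a (j x).
Proof.
move=> amA amP hj HS Sa x.
have : Hol S x by rewrite HS.
move=> /(_ (j @^-1` entire_values a)); apply.
split; first exact/holomorphically_closed_preimage/entire_values_closed.
move=> y Sy; have [|i _ iy] := Sa (j y); first by exists y.
by rewrite /preimage /= -iy; exact: entire_values_generator.
Qed.

Theorem proposition4p3 (R : realType) (A1 A2 : topAlgType R[i])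
    (hA1 : HFG A1) (hA2 : HFG A2)
    (P : topAlgType R[i]) (j1 : A1 -> P) (j2 : A2 -> P)
    (hP : analytic_free_product j1 j2) :
  HFG P.
Proof.
have [frA1 [S1 finS1 HS1]] := hA1; have [frA2 [S2 finS2 HS2]] := hA2.
have [amP hj1 hj2 univ] := hP; have [amA1 _] := frA1; have [amA2 _] := frA2.
have [L SL] : exists L : seq P, (j1 @` S1) `|` (j2 @` S2) = [set` L].
  by apply/finite_seqP; rewrite finite_setU; split; exact: finite_image.
pose a := tnth (in_tuple L).
have rangeL : [set` L] `<=` range a.
  move=> x /= xL; have [i ->] : exists i, x = a i by apply/tnthP.
  by exists i.
have X1 := hom_into_entire_values amA1 amP hj1 HS1 (_ : _ `<=` range a).
have {}X1 : forall x, entire_values a (j1 x).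
  by apply: X1 => x S1x; apply: rangeL; rewrite -SL; left.
have X2 : forall x, entire_values a (j2 x).
  apply: hom_into_entire_values amA2 amP hj2 HS2 _ => x S2x.
  by apply: rangeL; rewrite -SL; right.
have [i1 [hi1 i1E]] := entire_lift amP frA1 hj1 X1.
have [i2 [hi2 i2E]] := entire_lift amP frA2 hj2 X2.
have [phi [[hphi phi1 phi2] _]] := univ _ (entire_algebra_am amP a) _ _ hi1 hi2.
(* [entire_val \o phi] and the identity both extend j1 and j2 to P *)
have valphi x : entire_val (phi x) = x.
  have [psi [_ psiU]] := univ P amP _ _ hj1 hj2.
  have e1 : psi = entire_val \o phi.
    apply: psiU; split.
    - exact: continuous_hom_comp hphi (entire_val_hom amP a).
    - by apply/funext => y; rewrite -i1E -phi1.
    - by apply/funext => y; rewrite -i2E -phi2.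
  have e2 : psi = id by apply: psiU; split=> //; exact: continuous_hom_id.
  by rewrite -[LHS]/((entire_val \o phi) x) -e1 e2.
split; last first.
  exists (range a).
    by apply: finite_image; exact: finite_finset.
  apply/seteqP; split=> // x _; apply: (entire_values_Hol amP).
  by rewrite -(valphi x); exact: entire_valP.
split=> //.
have [_ hausP complP] := amP; split=> //.
pose q N x := @ssa_norm R P (entire_algebra_data amP a) N (phi x).
exists (range q); split.
- exact: card_image_le.
- move=> _ [N _ <-]; split.
  + by move=> x; exact: ssa_norm_ge0.
  + move=> x y; rewrite /q -[x]scale1r hom_linear// !scale1r; exact: ssa_normD.
  + by move=> k x; rewrite /q -[k *: x]addr0 hom_linear// hom0// addr0 ssa_normZ.
apply: topology_defined_byI.
  move=> _ x e [N _ <-] e0; have [_ _ cphi] := hphi.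
  have Ux := cphi x _ (@ssa_nbhs_ball R P (entire_algebra_data amP a) (phi x) N e e0).
  by apply: (@filterS _ (nbhs x) _ _ _ _ Ux) => y /=; rewrite /q homB.
move=> x U; rewrite -{1}(valphi x) => Ux.
have [_ _ cval] := entire_val_hom amP a.
have /ssa_nbhsP [N [e [e0 He]]] := cval (phi x) _ Ux.
exists (q N), e; split=> //.
by move=> y; rewrite /q homB// => /He /=; rewrite /= valphi.
Qed.
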